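(* Let $p\in[2,\infty)$ and $N\ge1$. Let $\Phi$ be a $\mathbf{\Phi}$-function such that $\Phi\in(\mathrm{aInc})_p$. There exist a positive universal numerical constant $c\ge1$ and a number $C(\Phi,p)\ge1$, depending only on $\Phi$ and $p$ (in particular not on $N$), such that for every compact $\Omega\subset\mathbb{R}^d$, any Borel probability measure $\mu$ on $\Omega$ and any function class $\mathbf{F}\subset C(\Omega)$, one has $$\varrho_{cN}(\mathbf{F},\|\cdot\|_{L^\Phi(\mu)})\le C(\Phi,p)\Bigl(\frac{\Phi(\sqrt N)}{N}\Bigr)^{1/p}d_N(\mathbf{F},\|\cdot\|_\infty).$$ Moreover, one can take $C(\Phi,p)$ to be of the form $$C(\Phi,p)=C\cdot C_\Phi\,a_\Phi(p)^{2/p}\bigl(1+(\Phi(1))^{-1}\bigr)^{1/p},$$ where $C\ge1$ is a universal numerical constant and $C_\Phi$ is the constant from the quasi-triangle inequality for $\|\cdot\|_{L^\Phi}$.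
   Context: ''Increasing'' is non-strict. A $\mathbf{\Phi}$-function is an increasing function $\Phi:[0,\infty)\to[0,\infty)$ with $\Phi(0)=0$, $\lim_{t\to0+}\Phi(t)=0$, $\lim_{t\to\infty}\Phi(t)=\infty$ and $\Phi\in(\mathrm{aInc})_1$. $\Phi\in(\mathrm{aInc})_p$ means that $t\mapsto\Phi(t)t^{-p}$ is almost increasing on $(0,\infty)$: there is a constant $a_\Phi(p)\ge1$ with $\Phi(s)s^{-p}\le a_\Phi(p)\Phi(t)t^{-p}$ for all $0<s<t$. $C(\Omega)$ is the space of continuous complex-valued functions on $\Omega$, $\|f\|_\infty=\max_\Omega|f|$. $\|f\|_{L^\Phi(\mu)}:=\inf\{\lambda>0:\int_\Omega\Phi(|f|/\lambda)\,d\mu\le1\}$, and $L^\Phi(\mu)$ is the space of (classes of) measurable $f$ with $\int\Phi(|f|/\lambda)\,d\mu<\infty$ for some $\lambda>0$. The functional $\|\cdot\|_{L^\Phi(\mu)}$ is a quasinorm; $C_\Phi>0$ denotes a constant with $\|f+g\|_{L^\Phi(\mu)}\le C_\Phi(\|f\|_{L^\Phi(\mu)}+\|g\|_{L^\Phi(\mu)})$ for all $f,g\in L^\Phi(\mu)$ and all probability measures $\mu$. Sampling numbers: for real $m\ge1$, $$\varrho_m(\mathbf{F},\|\cdot\|_{L^\Phi(\mu)}):=\inf_{\mathbf{x}}\ \inf_{T_{\mathbf{x}}}\ \sup_{f\in\mathbf{F}}\|f-T_{\mathbf{x}}(f(x_1),\dots,f(x_k))\|_{L^\Phi(\mu)},$$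 where the first infimum is over finite sets $\mathbf{x}=\{x_1,\dots,x_k\}\subset\Omega$ with $k\le m$ and the second over linear maps $T_{\mathbf{x}}:\mathbb{C}^k\to L^\Phi(\mu)$. Kolmogorov widths: $d_N(\mathbf{F},\|\cdot\|_\infty):=\inf_{X_N}\sup_{f\in\mathbf{F}}\inf_{u\in X_N}\|f-u\|_\infty$, the infimum being over $N$-dimensional subspaces $X_N\subset C(\Omega)$.
   Formalization: The formal theorem additionally assumes Φ(1) > 0, implicit in the factor (Φ(1))^{-1}; if Φ(1) = 0 the right-hand side vanishes at N = 1 while sampling numbers of the unit ball of C([0,1]) are positive, so the claim fails. *)

(* Defs.v *)
From mathcomp Require Import all_boot all_order all_algebra.
From mathcomp Require Import all_classical all_reals all_analysis.
From mathcomp Require Export complex.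
Set Implicit Arguments.
Unset Strict Implicit.
Unset Printing Implicit Defensive.
Import Order.TTheory GRing.Theory Num.Theory numFieldNormedType.Exports.
Local Open Scope classical_set_scope.
Local Open Scope ring_scope.

(* The library's topology on the numFieldType R[i] is keyed on its regular
   algebra alias. *)
Notation "R '.-C'" := ((R[i])^o) (at level 1, format "R .-C") : type_scope.

Notation borel T := (g_sigma_algebraType (@open T)).

(* Only the values of Phi on [0, +oo[ are constrained (and used below). *)
Definition aInc_with (R : realType) (Phi : R -> R) (p a : R) : Prop :=
  1 <= a /\
  forall s t : R, 0 < s -> s < t ->
    Phi s * s `^ (- p) <= a * (Phi t * t `^ (- p)).

Definition aInc (R : realType) (Phi : R -> R) (p : R) : Prop :=
  exists a : R, aInc_with Phi p a.

Record Phi_function (R : realType) (Phi : R -> R) : Prop := {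
  Phi_nonneg : forall t, 0 <= t -> 0 <= Phi t;
  Phi_increasing : forall s t, 0 <= s -> s <= t -> Phi s <= Phi t;
  Phi_zero : Phi 0 = 0;
  Phi_cvg0 : Phi t @[t --> 0^'+] --> (0 : R);
  Phi_cvgy : Phi t @[t --> +oo] --> +oo;
  Phi_aInc1 : aInc Phi 1 }.

(* A function on Omega is represented by a total function on R^d whose values
   outside Omega play no role.  A Borel probability measure on Omega is a Borel
   probability measure on R^d for which Omega has measure 1. *)
Section FunctionSpaces.
Variables (R : realType) (d : nat) (Omega : set 'rV[R]_d).
Implicit Types f : 'rV[R]_d -> R.-C.

Definition C_on : set ('rV[R]_d -> R.-C) :=
  [set f | {within Omega, continuous f}].

Definition sup_norm f : \bar R :=
  ereal_sup [set (Normc.normc (f x))%:E | x in Omega].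

(* Linear independence is that of the restrictions to Omega. *)
Definition C_subspace_of_dim (N : nat) (X : set ('rV[R]_d -> R.-C)) : Prop :=
  exists e : 'I_N -> ('rV[R]_d -> R.-C),
    [/\ forall i, C_on (e i),
        forall a : 'I_N -> R.-C,
          (forall x, Omega x -> \sum_(i < N) a i * e i x = 0) ->
          forall i, a i = 0 &
        X = [set u | exists a : 'I_N -> R.-C,
                       u = fun x => \sum_(i < N) a i * e i x]].

Definition kolmogorov_width (N : nat) (F : set ('rV[R]_d -> R.-C)) : \bar R :=
  ereal_inf
    [set ereal_sup
           [set ereal_inf [set sup_norm (fun x => f x - u x) | u in X]
           | f in F]
    | X in C_subspace_of_dim N].

Variables (Phi : R -> R) (mu : probability (borel 'rV[R]_d) R).

Definition modular f (l : R) : \bar R :=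
  \int[mu]_(x in Omega) (Phi (Normc.normc (f x) / l))%:E.

Definition LPhi_norm f : \bar R :=
  ereal_inf [set l%:E | l in [set l : R | 0 < l /\ (modular f l <= 1)%E]].

Definition LPhi : set ('rV[R]_d -> R.-C) :=
  [set f | measurable_fun (Omega : set (borel 'rV[R]_d))
             (f : borel 'rV[R]_d -> borel (R.-C)) /\
           exists l : R, 0 < l /\ (modular f l < +oo)%E].

(* Linear maps into the space of mu-classes: T v is a representative of the
   image of v, so that linearity holds mu-almost everywhere. *)
Definition LPhi_linear (k : nat) : set ('rV[R.-C]_k -> 'rV[R]_d -> R.-C) :=
  [set T | (forall v, LPhi (T v)) /\
           forall (a : R.-C) (v w : 'rV[R.-C]_k),
             {ae mu, forall x, Omega x ->
                T (a *: v + w) x = a * T v x + T w x}].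

Definition sampling_error (k : nat) (x : 'I_k -> 'rV[R]_d)
    (T : 'rV[R.-C]_k -> 'rV[R]_d -> R.-C)
    (F : set ('rV[R]_d -> R.-C)) : \bar R :=
  ereal_sup
    [set LPhi_norm (fun y => f y - T (\row_(i < k) f (x i)) y) | f in F].

Definition sampling_number (m : R) (F : set ('rV[R]_d -> R.-C)) : \bar R :=
  ereal_inf
    [set r | exists (k : nat) (x : 'I_k -> 'rV[R]_d),
       [/\ k%:R <= m, injective x, forall i, Omega (x i) &
           r = ereal_inf [set sampling_error x T F | T in @LPhi_linear k]]].

End FunctionSpaces.

Definition quasi_triangle_constant (R : realType) (Phi : R -> R) (K : R) :
    Prop :=
  0 < K /\
  forall (d : nat) (Omega : set 'rV[R]_d)
    (mu : probability (borel 'rV[R]_d) R),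
    compact Omega -> mu Omega = 1%E ->
    forall f g, LPhi Omega Phi mu f -> LPhi Omega Phi mu g ->
      (LPhi_norm Omega Phi mu (fun x => f x + g x)%R <=
       K%:E * (LPhi_norm Omega Phi mu f + LPhi_norm Omega Phi mu g))%E.

(* Main.v *)
Require Import Defs.
From mathcomp Require Import all_boot all_order all_algebra.
From mathcomp Require Import all_classical all_reals all_analysis.
From mathcomp Require Import perm zify ring lra.
Set Implicit Arguments.
Unset Strict Implicit.
Unset Printing Implicit Defensive.
Import Order.TTheory GRing.Theory Num.Theory numFieldNormedType.Exports.
Local Open Scope classical_set_scope.
Local Open Scope ring_scope.

(** Let X be an N-dimensional space of continuous functions on the compact set
    Omega.  All the work goes into one linear map T, depending on X and mu only,
    that reads at most 8 N samples, reproduces every element of X and is stable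
    in two norms at once: when the samples v are bounded by E, the function T v
    satisfies int |T v|^2 dmu <= 12 E^2 and |T v|^2 <= 192 N E^2 on Omega
    ([space_recovery]).  If u in X is within E of f on Omega, linearity gives
    f - T f = (f - u) - T (f - u), so the error h has L^2(mu) norm at most 20 E
    and uniform norm at most 20 sqrt N E.

    These two bounds are exactly what the growth of Phi can use.  Put
    t = |h| / (20 E), which ranges over [0, sqrt N], and let M be the
    [growth_factor], so that
    M^p = a^2 (1 + 1 / Phi 1) Phi (sqrt N) / N.  Almost monotonicity of
    Phi(t) t^-p and p >= 2 give Phi (t / M) <= t^2 ([Phi_le_sqr]), whence
    int Phi (|h| / (20 E M)) dmu <= int t^2 dmu <= 1 and ||h|| <= 20 M E
    ([projection_error]).  The infimum over u, the supremum over f and the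
    infimum over X turn this into the bound by the width.  The
    error is split pointwise, through |z + w|^2 <= 2 |z|^2 + 2 |w|^2; the
    constant with the factor C_Phi is then at least as large as the one obtained,
    because C_Phi >= 1 ([quasi_triangle_constant_ge1]).

    The map T is least squares on suitable points x_1, .., x_k, a projection
    that does not increase the Euclidean norm of the data.  Both stability
    bounds therefore reduce to inequalities for u in X
    ([sampling_points]):
      int |u|^2 dmu <= (3 / (2 N)) sum_j |u(x_j)|^2 and
      |u(y)|^2 <= 24 sum_j |u(x_j)|^2 for y in Omega.
    Separating real and imaginary parts turns X into a real space of dimension
    n = 2 N, and the two inequalities have different origins.

    - The uniform bound comes from the extremal principle of optimal design: 2 n
      vectors that nearly maximise the determinant of their second moment
      matrix control all the others, because exchanging one of them for a new
      vector cannot increase the determinant by much ([near_optimal_sample]).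
    - The L^2 bound comes from the lower half of the barrier argument of Batson,
      Spielman and Srivastava: for a probability measure on R^n with second
      moment matrix G, there are 4 n vectors w in its support with
      G <= (1 / n) sum w^T w ([lower_frame]).  It is applied to the average of
      mu, for real and imaginary parts, and of the uniform measure on the design
      points, so that its output also inherits the uniform bound. *)

(** * Quadratic forms, positive definite matrices and rank-one updates *)

(** [qf 1%:M u v] is the dot product of [u] and [v]; keeping it in this form lets
    the same rewriting rules serve both. *)
Definition qf (R : pzRingType) n (W : 'M[R]_n) (u v : 'rV[R]_n) : R :=
  (u *m W *m v^T) 0 0.

Definition posdef (R : numDomainType) n (A : 'M[R]_n) : Prop :=
  A^T = A /\ forall v, v != 0 -> 0 < qf A v v.

Section BilinearForms.
Variables (R : comPzRingType) (n : nat).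
Implicit Types (A B W : 'M[R]_n) (u v w : 'rV[R]_n).

Lemma qf_trace W u v : qf W u v = \tr (W *m (v^T *m u)).
Proof.
by rewrite mulmxA mxtrace_mulC -/(mxtrace _) /qf /mxtrace big_ord1 mulmxA.
Qed.

Lemma qfD A B u v : qf (A + B) u v = qf A u v + qf B u v.
Proof. by rewrite /qf mulmxDr mulmxDl mxE. Qed.

Lemma qfZ a A u v : qf (a *: A) u v = a * qf A u v.
Proof. by rewrite /qf -scalemxAr -scalemxAl mxE. Qed.

Lemma qfN A u v : qf (- A) u v = - qf A u v.
Proof. by rewrite -scaleN1r qfZ mulN1r. Qed.

Lemma qfB A B u v : qf (A - B) u v = qf A u v - qf B u v.
Proof. by rewrite qfD qfN. Qed.

Lemma qf0 u v : qf 0 u v = 0.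
Proof. by rewrite /qf mulmx0 mul0mx mxE. Qed.

Lemma qf_sum I (s : seq I) (F : I -> 'M[R]_n) u v :
  qf (\sum_(i <- s) F i) u v = \sum_(i <- s) qf (F i) u v.
Proof.
elim: s => [|i s IHs]; first by rewrite !big_nil qf0.
by rewrite !big_cons qfD IHs.
Qed.

Lemma qfDl A u v w : qf A (u + v) w = qf A u w + qf A v w.
Proof. by rewrite /qf !mulmxDl mxE. Qed.

Lemma qfZl A a u v : qf A (a *: u) v = a * qf A u v.
Proof. by rewrite /qf -!scalemxAl mxE. Qed.

Lemma qfC A u v : A^T = A -> qf A u v = qf A v u.
Proof.
move=> AT; have -> : qf A u v = ((u *m A *m v^T)^T) 0 0 by rewrite [RHS]mxE.
rewrite !trmx_mul trmxK AT mulmxA.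
by [].
Qed.

Lemma qf_mul2 A B u v : qf (A *m B *m A^T) u v = qf B (u *m A) (v *m A).
Proof. by rewrite /qf trmx_mul !mulmxA. Qed.

Lemma qf_rank1 u v w : qf (u^T *m u) v w = qf 1%:M u v * qf 1%:M u w.
Proof.
have vu : (v *m u^T) 0 0 = qf 1%:M u v by rewrite /qf mulmx1 -[v *m _]trmxK trmx_mul trmxK mxE.
by rewrite /qf mulmxA -mulmxA mxE big_ord1 vu /qf !mulmx1.
Qed.
End BilinearForms.

Section PositiveDefinite.
Variables (R : realType) (n : nat).
Implicit Types (A B W : 'M[R]_n) (u v w : 'rV[R]_n).

Lemma posdef_sym A : posdef A -> A^T = A.
Proof. by case. Qed.

Lemma posdef_ge0 A v : posdef A -> 0 <= qf A v v.
Proof.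
move=> [_ A0]; have [->|/A0/ltW //] := eqVneq v 0.
by rewrite /qf !mul0mx mxE.
Qed.

Lemma posdef_unit A : posdef A -> A \in unitmx.
Proof.
move=> [_ A0]; rewrite -row_free_unit -kermx_eq0; apply/rowV0P => v /sub_kermxP vA.
apply: contraTeq isT => /A0; rewrite /qf vA mul0mx mxE ltxx //.
Qed.

Lemma posdef_conj A B : A \in unitmx -> posdef B -> posdef (A *m B *m A^T).
Proof.
move=> uA [BT B0]; split; first by rewrite !trmx_mul trmxK BT mulmxA.
move=> v v0; rewrite qf_mul2; apply: B0; apply: contraNneq v0 => vA.
by rewrite -(mulmxK uA v) vA mul0mx.
Qed.

Lemma posdef_inv A : posdef A -> posdef (invmx A).
Proof.
move=> pA; have uA := posdef_unit pA; have AT := posdef_sym pA.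
have -> : invmx A = invmx A *m A *m (invmx A)^T.
  by rewrite mulVmx // mul1mx trmx_inv AT.
by apply: posdef_conj => //; rewrite unitmx_inv.
Qed.

Lemma posdefD A B : posdef A -> posdef B -> posdef (A + B).
Proof.
move=> pA pB; split; first by rewrite linearD /= !posdef_sym.
by move=> v v0; rewrite qfD ltr_wpDr ?posdef_ge0 //; case: pA => _; apply.
Qed.

Lemma posdefZ a A : 0 < a -> posdef A -> posdef (a *: A).
Proof.
move=> a0 [AT A0]; split; first by rewrite linearZ /= AT.
by move=> v v0; rewrite qfZ mulr_gt0 // A0.
Qed.

Lemma sym_rank1 u : (u^T *m u)^T = u^T *m u.
Proof. by rewrite trmx_mul trmxK. Qed.

Lemma qf_rank1_ge0 u v : 0 <= qf (u^T *m u) v v.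
Proof. by rewrite qf_rank1 -expr2 sqr_ge0. Qed.

Lemma posdefD_rank1 t A u : 0 <= t -> posdef A -> posdef (A + t *: (u^T *m u)).
Proof.
move=> t0 pA; split; first by rewrite linearD linearZ /= sym_rank1 posdef_sym.
move=> v v0; rewrite qfD qfZ ltr_wpDr ?mulr_ge0 ?qf_rank1_ge0 //.
by case: pA => _; apply.
Qed.

Lemma qf_cauchy_schwarz A u v : posdef A ->
  qf A u v ^+ 2 <= qf A u u * qf A v v.
Proof.
move=> pA; have AT := posdef_sym pA.
have [->|v0] := eqVneq v 0.
  by rewrite /qf trmx0 !mulmx0 mxE expr0n /= mulr0.
have vv : 0 < qf A v v by case: pA => _; apply.
pose s := - (qf A u v / qf A v v).
have := posdef_ge0 (u + s *: v) pA.
rewrite qfDl qfZl ![qf A _ (u + _)]qfC // !qfDl !qfZl (qfC v u AT).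
have -> : qf A u u + s * qf A u v + s * (qf A u v + s * qf A v v) =
  qf A u u - qf A u v ^+ 2 / qf A v v by rewrite /s; field; rewrite gt_eqF.
by rewrite subr_ge0 ler_pdivrMr.
Qed.

(** Duality between the norms of [A] and of its inverse: this is how a bound on
    the leverage of [u], the value of the inverse at [u], becomes a bound on the
    linear form defined by [u]. *)
Lemma dot_cauchy_schwarz A u v : posdef A ->
  qf 1%:M u v ^+ 2 <= qf (invmx A) u u * qf A v v.
Proof.
move=> pA; have uA := posdef_unit pA.
have -> : qf 1%:M u v = qf A (u *m invmx A) v.
  by rewrite /qf mulmxKV // mulmx1.
apply: le_trans (qf_cauchy_schwarz _ _ pA) _.
by rewrite -qf_mul2 mulVmx // mul1mx trmx_inv posdef_sym.
Qed.

(** Sherman-Morrison formula. *)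
Lemma invmx_rank1 A u t : posdef A -> 1 + t * qf (invmx A) u u != 0 ->
  invmx (A + t *: (u^T *m u)) =
  invmx A - (t / (1 + t * qf (invmx A) u u)) *:
            (invmx A *m u^T *m u *m invmx A).
Proof.
move=> pA; set a := qf _ u u => a0; have uA := posdef_unit pA.
set B := _ + _; set C := _ - _.
suff BC : B *m C = 1%:M.
  by have [uB _] := mulmx1_unit BC; rewrite -(mulKmx uB C) BC mulmx1.
have E : u *m invmx A *m u^T = a%:M.
  by rewrite [LHS]mx11_scalar.
have Ap : A *m (invmx A *m u^T) = u^T by rewrite mulKVmx.
have {}E : u *m (invmx A *m u^T) = a%:M by rewrite mulmxA.
rewrite /B /C -(mulmxA (invmx A *m u^T)).
set w := invmx A *m u^T in Ap E *; set q := u *m invmx A.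
rewrite mulmxDl !mulmxBr mulmxV // -scalemxAr (mulmxA A) Ap -!scalemxAl.
rewrite -(mulmxA _ u (invmx A)) -/q -scalemxAr (mulmxA _ w) -(mulmxA _ u w) E.
rewrite mul_mx_scalar -scalemxAl scalerA.
rewrite scalerA -scalerBl -addrA -scaleNr -scalerDl.
have -> : - (t / (1 + t * a)) + (t - t * (t / (1 + t * a)) * a) = 0 by field.
by rewrite scale0r addr0.
Qed.

Lemma trace_invmx_rank1 A G u t : posdef A -> 1 + t * qf (invmx A) u u != 0 ->
  \tr (invmx (A + t *: (u^T *m u)) *m G) = \tr (invmx A *m G) -
    t / (1 + t * qf (invmx A) u u) * qf (invmx A *m G *m invmx A) u u.
Proof.
move=> pA a0; rewrite invmx_rank1 // mulmxBl linearB /= -scalemxAl linearZ /=.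
congr (_ - _ * _).
by rewrite qf_trace -(mulmxA _ _ G) mxtrace_mulC !mulmxA.
Qed.

(** By Sherman-Morrison, a positive rank-one update subtracts a square from the
    inverse. *)
Lemma qf_invmx_rank1 A u v : posdef A ->
  qf (invmx (A + u^T *m u)) v v <= qf (invmx A) v v.
Proof.
move=> pA; have pX := posdef_inv pA; have a0 := posdef_ge0 u pX.
rewrite -[u^T *m u]scale1r invmx_rank1 // ?mul1r ?lt0r_neq0 ?ltr_pwDl //.
rewrite qfB qfZ lerBlDr lerDl mulr_ge0 ?invr_ge0 ?addr_ge0 //.
rewrite -(mulmxA _ u^T u) -{2}(posdef_sym pX) qf_mul2.
exact: qf_rank1_ge0.
Qed.

(** Matrix determinant lemma: both Schur complements of one bordered matrix
    compute its determinant. *)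
Lemma det_rank1 A u t : A \in unitmx ->
  \det (A + t *: (u^T *m u)) = \det A * (1 + t * qf (invmx A) u u).
Proof.
move=> uA.
have det1 (w : 'cV[R]_n) (v : 'rV[R]_n) :
    \det (1%:M + w *m v) = 1 + (v *m w) 0 0.
  pose L := block_mx (1%:M : 'M[R]_1) 0 (- w) 1%:M.
  have detL : \det L = 1 by rewrite det_lblock !det1 mul1r.
  transitivity (\det (block_mx (1%:M : 'M[R]_1) v (- w) 1%:M)).
    have -> : block_mx (1%:M : 'M[R]_1) v (- w) 1%:M =
              L *m block_mx 1%:M v 0 (1%:M + w *m v).
      rewrite mulmx_block !mul0mx !mulmx1 !mul1mx ?mulmx0 !addr0.
      by rewrite mulNmx addrCA addNr addr0.
    by rewrite det_mulmx detL mul1r det_ublock det1 mul1r.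
  have -> : block_mx (1%:M : 'M[R]_1) v (- w) 1%:M =
            block_mx (1%:M + v *m w) v 0 1%:M *m L.
    rewrite mulmx_block !mul0mx !mulmx1 !mul1mx ?mulmx0 !add0r.
    by rewrite mulmxN addrK.
  by rewrite det_mulmx detL mulr1 det_ublock det1 mulr1 det_mx11 !mxE eqxx.
have -> : A + t *: (u^T *m u) = A *m (1%:M + (t *: (invmx A *m u^T)) *m u).
  by rewrite mulmxDr mulmx1 -scalemxAl -scalemxAr !mulmxA mulmxV // mul1mx.
rewrite det_mulmx det1 -scalemxAr mxE; congr (_ * (1 + _ * _)).
by rewrite /qf mulmxA.
Qed.
End PositiveDefinite.

(** * Quadrature from below with linearly many nodes *)

Definition second_moment (R : realType) n (s : seq 'rV[R]_n) : 'M[R]_n :=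
  \sum_(w <- s) w^T *m w.

(** Here [G] plays the second moment matrix of a probability measure carried by
    [Gam]; [G_average] retains from that measure only that it is a positive
    functional of mass one on the quadratic forms and the constants. *)
Section LowerBarrier.
Variables (R : realType) (n : nat) (Gam : set 'rV[R]_n) (G : 'M[R]_n).
Hypothesis G_posdef : posdef G.
Hypothesis G_average : forall (V : 'M[R]_n) (c : R),
  (forall u, Gam u -> qf V u u <= c) -> \tr (V *m G) <= c.
Implicit Types (D X Y W : 'M[R]_n) (u v : 'rV[R]_n).

Lemma average_exists V c : c < \tr (V *m G) -> exists2 u, Gam u & c < qf V u u.
Proof.
move=> cV; apply: contrapT => nu; move: cV; apply/negP; rewrite -leNgt.
apply: G_average => u Gu; rewrite leNgt; apply/negP => cu.
by apply: nu; exists u.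
Qed.

Lemma average_ge0 V : (forall u, 0 <= qf V u u) -> 0 <= \tr (V *m G).
Proof.
move=> V0; rewrite -oppr_le0 -linearN /= -mulNmx; apply: G_average => u _.
by rewrite qfN oppr_le0.
Qed.

(** Mean of the pointwise Cauchy-Schwarz inequality
    (u.v)^2 <= (u W^-1 u) (v W v). *)
Lemma moment_le_trace W v : posdef W ->
  qf G v v <= \tr (invmx W *m G) * qf W v v.
Proof.
move=> pW; rewrite -subr_ge0.
have -> : \tr (invmx W *m G) * qf W v v - qf G v v =
    \tr ((qf W v v *: invmx W - v^T *m v) *m G).
  rewrite mulmxBl -scalemxAl linearB linearZ /= mulrC; congr (_ - _).
  by rewrite mxtrace_mulC -qf_trace.
apply: average_ge0 => u; rewrite qfB qfZ qf_rank1 subr_ge0 -expr2 mulrC.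
by rewrite [qf _ v u]qfC ?trmx1 //; apply: dot_cauchy_schwarz.
Qed.

Lemma trace_gt0 W : (0 < n)%N -> posdef W -> 0 < \tr (W *m G).
Proof.
move=> n0 pW; pose v : 'rV[R]_n := delta_mx 0 (Ordinal n0).
have v0 : v != 0.
  apply/eqP => /matrixP/(_ 0 (Ordinal n0)); rewrite !mxE !eqxx => /eqP.
  by rewrite oner_eq0.
have pW' := posdef_inv pW; have := moment_le_trace v pW'; rewrite invmxK => h.
have := lt_le_trans (G_posdef.2 v v0) h.
by rewrite pmulr_lgt0 //; exact: pW'.2.
Qed.

(** Mean of the value of [X] at the vectors u (U - s), expanded as a polynomial
    in [s]. *)
Lemma trace_cauchy_schwarz X U : posdef X -> forall s,
  0 <= \tr (U *m X *m U^T *m G) - 2 * s * \tr (U *m X *m G)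
       + s ^+ 2 * \tr (X *m G).
Proof.
move=> pX s.
have := @average_ge0 ((U - s%:M) *m X *m (U - s%:M)^T).
have -> : \tr ((U - s%:M) *m X *m (U - s%:M)^T *m G) =
  \tr (U *m X *m U^T *m G) - 2 * s * \tr (U *m X *m G) + s ^+ 2 * \tr (X *m G).
  have tr1 : \tr (X *m U^T *m G) = \tr (U *m X *m G).
    rewrite -mxtrace_tr !trmx_mul trmxK (posdef_sym pX) (posdef_sym G_posdef).
    by rewrite mxtrace_mulC.
  rewrite linearB /= tr_scalar_mx mulmxBl mul_scalar_mx mulmxBr !mulmxBl.
  rewrite !mul_mx_scalar -!scalemxAl.
  by do 2!rewrite !(mxtraceD, mxtraceZ, raddfN) /=; rewrite !mxtraceZ tr1; ring.
by apply => u; rewrite qf_mul2 posdef_ge0.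
Qed.

(** One step of the lower barrier argument, with step length 1 and weight 2.  The
    matrix [D] is the accumulated sum minus the barrier times [G]; the trace of
    D^-1 G measures how close the barrier is to the bottom of the spectrum.
    Raising the barrier by 1 increases this potential by [Delta], while adding
    the vector u with weight 2 decreases it by
    2 (u Y G Y u) / (1 + 2 (u Y u)), with Y the new inverse.  Averaging over u
    shows that some u more than compensates. *)
Lemma barrier_step D : (0 < n)%N -> posdef D -> \tr (invmx D *m G) <= 1 / 2 ->
  exists u, [/\ Gam u, posdef (D - G + 2 *: (u^T *m u)) &
    \tr (invmx (D - G + 2 *: (u^T *m u)) *m G) <= 1 / 2].
Proof.
move=> n0 pD P12; set X := invmx D in P12 *; set P := \tr _ in P12.
have pX : posdef X by exact: posdef_inv.
have pD' : posdef (D - G).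
  split; first by rewrite linearB /= !posdef_sym.
  move=> v v0; rewrite qfB subr_gt0; apply: le_lt_trans (moment_le_trace v pD) _.
  by have := pD.2 v v0; rewrite -/X -/P; nra.
set D' := D - G in pD' *; set Y := invmx D'.
have pY : posdef Y by exact: posdef_inv.
have YT := posdef_sym pY; have XT := posdef_sym pX; have GT := posdef_sym G_posdef.
have YXG : Y - X = X *m G *m Y.
  have -> : G = D - D' by rewrite /D' opprB addrC subrK.
  rewrite mulmxBr mulmxBl mulVmx ?posdef_unit // mul1mx -mulmxA mulmxV ?posdef_unit //.
  by rewrite mulmx1.
have YGX : Y - X = Y *m G *m X.
  have := congr1 trmx YXG; rewrite linearB /= !trmx_mul YT XT GT.
  by rewrite mulmxA.
pose Delta := \tr ((Y - X) *m G).
have Delta0 : 0 < Delta.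
  apply: trace_gt0 => //; rewrite YXG.
  have -> : Y = X + Y *m G *m X by rewrite -YGX addrC subrK.
  rewrite mulmxDr; have uX := posdef_unit pX; have uG := posdef_unit G_posdef.
  apply: posdefD; first by rewrite -{2}XT; apply: posdef_conj.
  rewrite !mulmxA -(mulmxA (X *m G *m Y)).
  have -> : X *m G *m Y *m (G *m X) = (X *m G) *m Y *m (X *m G)^T.
    by rewrite trmx_mul XT GT.
  by apply: posdef_conj => //; rewrite unitmx_mul uX.
have P' : \tr (Y *m G) = P + Delta.
  by rewrite /Delta mulmxBl linearB /= -/P addrC subrK.
pose q := \tr (Y *m G *m Y *m G).
(* Cauchy-Schwarz at s = Delta bounds q from below; with P <= 1/2 this exceeds
   what the averaging argument needs. *)
have q_lb : Delta + 2 * Delta ^+ 2 - P * Delta ^+ 2 <= q.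
  have := @trace_cauchy_schwarz X (Y *m G) pX Delta.
  rewrite trmx_mul YT GT -YGX -/Delta -/P.
  have -> : \tr ((Y - X) *m (G *m Y) *m G) = q - Delta.
    rewrite !mulmxA !mulmxBl linearB /= -/q; congr (_ - _).
    by rewrite -YXG.
  lra.
have : Delta < \tr ((2 *: (Y *m G *m Y) - (2 * Delta) *: Y) *m G).
  rewrite mulmxBl raddfB /= -!scalemxAl !mxtraceZ -/q P'.
  have h1 : 0 <= Delta * (1 / 2 - P).
    by apply: mulr_ge0; [exact: ltW|rewrite subr_ge0].
  have h2 : 0 <= Delta ^+ 2 * (1 / 2 - P) 
    by apply: mulr_ge0; [exact: sqr_ge0|rewrite subr_ge0].
  have h3 : 0 < Delta ^+ 2 by rewrite exprn_gt0.
  lra.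
case/average_exists => u Gu; rewrite qfB !qfZ => hu.
exists u; split => //; first exact: posdefD_rank1.
have a0 := posdef_ge0 u pY.
rewrite trace_invmx_rank1 -/Y //; last by rewrite gt_eqF // ltr_pwDl // mulr_ge0.
rewrite P'; apply: le_trans P12; rewrite lerBlDr lerD2l mulrAC ler_pdivlMr.
  by nra.
by rewrite ltr_pwDl // mulr_ge0.
Qed.

(** Starting with the empty sum and the barrier at - 2 n, where the potential is
    exactly 1/2, after 4 n steps of length 1 the barrier stands at 2 n while each
    vector has received weight 2. *)
Theorem lower_frame : (0 < n)%N -> exists s : seq 'rV[R]_n,
  [/\ size s = (4 * n)%N, forall w, w \in s -> Gam w &
      forall v, qf G v v <= n%:R^-1 * qf (second_moment s) v v].
Proof.
move=> n0.
have : exists s : seq 'rV[R]_n, let D := 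
  2 *: second_moment s - ((size s)%:R - (2 * n)%:R) *: G in
  [/\ size s = (4 * n)%N, forall w, w \in s -> Gam w, posdef D &
      \tr (invmx D *m G) <= 1 / 2].
  elim: (4 * n)%N => [|k [s /= [sk sG pD trD]]].
    have n2 : 0 < (2 * n)%:R :> R by rewrite ltr0n muln_gt0.
    exists [::]; rewrite /second_moment big_nil scaler0 !sub0r -scaleNr opprK; split=> //.
      exact: posdefZ.
    rewrite invmxZ; last by apply/posdef_unit/posdefZ.
    rewrite -scalemxAl mulVmx ?posdef_unit // mxtraceZ mxtrace1 natrM invfM.
    by rewrite -mulrA mulVf ?mulr1 ?div1r // pnatr_eq0 -lt0n.
  have [u [Gu pD' trD']] := barrier_step n0 pD trD.
  exists (u :: s) => /=.
  have -> : 2 *: second_moment (u :: s) - ((size s).+1%:R - (2 * n)%:R) *: G =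
    2 *: second_moment s - ((size s)%:R - (2 * n)%:R) *: G - G + 2 *: (u^T *m u).
    have -> : (size s).+1%:R - (2 * n)%:R = ((size s)%:R - (2 * n)%:R) + 1 :> R.
      by rewrite -natr1 addrAC.
    rewrite /second_moment big_cons scalerDr [(_ + 1) *: G]scalerDl scale1r opprD.
    by rewrite -[LHS]addrA [LHS]addrC !addrA.
  split=> //; first by rewrite sk.
  by move=> w; rewrite inE => /predU1P[->|/sG].
case=> s [sn sG pD _]; exists s; split=> // v.
have := posdef_ge0 v pD; rewrite qfB !qfZ sn subr_ge0 !natrM => h.
by rewrite ler_pdivlMl ?ltr0n //; lra.
Qed.
End LowerBarrier.

(** * Sampling controls the uniform norm *)

Section NearlyOptimalDesign.
Variables (R : realType) (n : nat) (Gam : set 'rV[R]_n) (b : R).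
Hypothesis Gam_bounded : forall u i, Gam u -> `|u 0 i| <= b.
Hypothesis Gam_spanning : forall v : 'rV[R]_n, (forall u, Gam u -> qf 1%:M u v = 0) -> v = 0.

Let in_Gam (s : seq 'rV[R]_n) := forall w, w \in s -> Gam w.

Lemma second_moment_sym (s : seq 'rV[R]_n) : (second_moment s)^T = second_moment s.
Proof.
rewrite /second_moment raddf_sum; apply: eq_bigr => w _; exact: sym_rank1.
Qed.

Lemma qf_second_moment (s : seq 'rV[R]_n) v :
  qf (second_moment s) v v = \sum_(w <- s) (qf 1%:M w v) ^+ 2.
Proof.
by rewrite /second_moment qf_sum; apply: eq_bigr => w _; rewrite qf_rank1 expr2.
Qed.

(** Leibniz expansion with entries bounded by k b^2. *)
Lemma det_second_moment_bounded k : exists B, forall s, size s = k -> in_Gam s ->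
  `|\det (second_moment s)| <= B.
Proof.
exists (\sum_(sg : 'S_n) (\prod_(i < n) (k%:R * b ^+ 2))) => s sk sG.
apply: le_trans (ler_norm_sum _ _ _) _.
apply: ler_sum => sg _; rewrite normrM normrX normrN1 expr1n mul1r normr_prod.
apply: ler_prod => i _; rewrite normr_ge0 /second_moment summxE.
apply: le_trans (ler_norm_sum _ _ _) _.
rewrite -sk -sum1_size natr_sum mulr_suml big_seq [leRHS]big_seq.
apply: ler_sum => w ws; rewrite mxE big_ord1 !mxE mul1r normrM expr2.
by apply: ler_pM => //; apply: Gam_bounded; exact: sG.
Qed.

(** A vector at which this sum of squares vanishes is orthogonal to every member
    of [s]. *)
Lemma second_moment_ker (s : seq 'rV[R]_n) v :
  qf (second_moment s) v v = 0 -> v *m second_moment s = 0.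
Proof.
rewrite qf_second_moment => /eqP; rewrite psumr_eq0; last by move=> *; exact: sqr_ge0.
move=> /allP sv; rewrite /second_moment mulmx_sumr big_seq big1 // => w ws.
have := sv w ws; rewrite sqrf_eq0 /= => /eqP wv; rewrite mulmxA.
suff -> : v *m w^T = 0 by rewrite mul0mx.
apply/matrixP => i j; rewrite !ord1 [RHS]mxE -wv qfC ?trmx1 //.
by rewrite /qf mulmx1.
Qed.

Lemma second_moment_posdef (s : seq 'rV[R]_n) :
  second_moment s \in unitmx -> posdef (second_moment s).
Proof.
move=> uA; split=> [|v v0]; first exact: second_moment_sym.
rewrite lt_neqAle qf_second_moment sumr_ge0 ?andbT => [|w _]; last exact: sqr_ge0.
rewrite eq_sym -qf_second_moment; apply: contraNneq v0 => /second_moment_ker vA.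
by rewrite -(mulmxK uA v) vA mul0mx.
Qed.

(** As long as the second moment matrix is singular, a vector of [Gam] that is
    not orthogonal to its kernel makes that kernel strictly smaller. *)
Lemma spanning_sample k : (0 < n)%N -> exists s,
  [/\ size s = k, in_Gam s & (minn k n <= \rank (second_moment s))%N].
Proof.
move=> n0; elim: k => [|k [s [sk sG rs]]]; first by exists [::]; rewrite min0n.
have [v [v0 vs]] : exists v : 'rV[R]_n,
    v != 0 /\ (v *m second_moment s = 0 \/ second_moment s \in unitmx).
  have [uA|nuA] := boolP (second_moment s \in unitmx).
    exists (delta_mx 0 (Ordinal n0)); split; last by right.
    apply/eqP => /matrixP/(_ 0 (Ordinal n0)); rewrite !mxE !eqxx => /eqP.
    by rewrite oner_eq0.
  move: nuA; rewrite -row_free_unit -kermx_eq0 => /rowV0Pn[v /sub_kermxP vA v0].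
  by exists v; split=> //; left.
have [u Gu uv] : exists2 u, Gam u & qf 1%:M u v != 0.
  apply: contrapT => nu; move/eqP: v0; apply; apply: Gam_spanning => u Gu.
  by apply/eqP/negPn/negP => uv; apply: nu; exists u.
exists (u :: s); split; first by rewrite /= sk.
  by move=> w; rewrite inE => /predU1P[->|/sG].
case: vs => [vA|/second_moment_posdef pA]; last first.
  suff /mxrank_unit -> : second_moment (u :: s) \in unitmx by rewrite geq_minr.
  rewrite /second_moment big_cons addrC -[u^T *m u]scale1r.
  by apply: posdef_unit; exact: posdefD_rank1.
suff : (kermx (second_moment (u :: s)) < kermx (second_moment s))%MS.
  move=> /rank_ltmx; rewrite !mxrank_ker.
  have := rank_leq_row (second_moment s).
  have := rank_leq_row (second_moment (u :: s)).
  by move: rs; rewrite !geq_min; lia.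
have Akuv w : w *m second_moment (u :: s) = 0 ->
    w *m second_moment s = 0 /\ qf 1%:M u w = 0.
  move=> wA; have : qf (second_moment (u :: s)) w w = 0.
    by rewrite /qf wA mul0mx mxE.
  rewrite qf_second_moment big_cons -qf_second_moment => /eqP.
  rewrite paddr_eq0 ?sqr_ge0 //; last first.
    by rewrite qf_second_moment sumr_ge0 // => *; exact: sqr_ge0.
  by rewrite sqrf_eq0 => /andP[/eqP -> /eqP /second_moment_ker].
apply/andP; split.
  by apply/rV_subP => w /sub_kermxP/Akuv[wA _]; apply/sub_kermxP.
apply/negP => /rV_subP/(_ v); rewrite !sub_kermx vA eqxx => /(_ isT)/eqP/Akuv[_].
exact/eqP.
Qed.

Lemma sum_leverage (s : seq 'rV[R]_n) : second_moment s \in unitmx ->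
  \sum_(w <- s) qf (invmx (second_moment s)) w w = n%:R.
Proof.
move=> uA; under eq_bigr do rewrite qf_trace.
rewrite -raddf_sum -mulmx_sumr /=.
by rewrite -/(second_moment s) mulVmx ?mxtrace1.
Qed.

(** The exchange consists of two rank-one updates; inserting [u] before removing
    [w] can only lower the leverage of [w]. *)
Lemma det_swap (s : seq 'rV[R]_n) u w : posdef (second_moment s) -> w \in s ->
  `|\det (second_moment s)| * ((1 + qf (invmx (second_moment s)) u u) *
                                (1 - qf (invmx (second_moment s)) w w)) <=
  `|\det (second_moment (u :: rem w s))|.
Proof.
move=> pA ws; have a0 := posdef_ge0 u (posdef_inv pA).
have pB := posdefD_rank1 u ler01 pA.
have -> : second_moment (u :: rem w s) =
    second_moment s + 1 *: (u^T *m u) + (-1) *: (w^T *m w).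
  rewrite [X in X + _ + _](_ : _ = w^T *m w + second_moment (rem w s)).
    by rewrite /second_moment big_cons scale1r scaleN1r addrAC (addrC (w^T *m w)) addrK addrC.
  by rewrite /second_moment (perm_big _ (perm_to_rem ws)) big_cons.
rewrite det_rank1 ?posdef_unit // det_rank1 ?posdef_unit // !normrM -mulrA.
rewrite ler_wpM2l // mul1r (ger0_norm (addr_ge0 ler01 a0)) ler_wpM2l ?addr_ge0 //.
apply: le_trans (ler_norm _); rewrite mulN1r lerD2l lerN2 scale1r.
exact: qf_invmx_rank1.
Qed.

(** Let the absolute determinant of [s] be at least 2/3 of its supremum over
    2 n-tuples.  Every exchange multiplies it by at most 3/2, so
    (1 + a) (1 - b_w) <= 3/2 for the leverages a of [u] and b_w of each w in
    [s].  The b_w sum to n, and summing over the 2 n members w gives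
    (1 + a) n <= 3 n.  A near-maximiser suffices, so that boundedness of [Gam]
    replaces compactness. *)
Theorem near_optimal_sample : (0 < n)%N -> exists s : seq 'rV[R]_n,
  [/\ size s = (2 * n)%N, in_Gam s, posdef (second_moment s) &
      forall u v, Gam u -> qf 1%:M u v ^+ 2 <= 2 * qf (second_moment s) v v].
Proof.
move=> n0; pose E := [set x | exists s, [/\ size s = (2 * n)%N, in_Gam s &
  x = `|\det (second_moment s)|]].
have [s0 [s0n s0G s0r]] := spanning_sample (2 * n) n0.
have u0 : second_moment s0 \in unitmx.
  rewrite -row_free_unit -row_leq_rank; apply: leq_trans s0r.
  by rewrite leq_min leqnn leq_pmull.
have [B EB] := det_second_moment_bounded (2 * n).
have supE : has_sup E.
  by split; [exists `|\det (second_moment s0)|; exists s0|exists B => x [s [sn sG ->]]; exact: EB].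
have E0 : 0 < sup E.
  apply: (@lt_le_trans _ _ `|\det (second_moment s0)|).
    by rewrite normr_gt0 -unitfE -unitmxE.
  by apply: sup_upper_bound => //; exists s0.
have [|_ [s [sn sG ->]] sE] := @sup_adherent _ E (sup E / 3) _ supE.
  by rewrite divr_gt0.
have pA : posdef (second_moment s).
  apply: second_moment_posdef; rewrite unitmxE unitfE -normr_gt0.
  by apply: lt_trans sE; lra.
have swap u w : Gam u -> w \in s -> (1 + qf (invmx (second_moment s)) u u) *
    (1 - qf (invmx (second_moment s)) w w) <= 3 / 2.
  move=> Gu ws; have det0 : 0 < `|\det (second_moment s)|.
    by rewrite normr_gt0 -unitfE -unitmxE posdef_unit.
  rewrite -(ler_pM2l det0); apply: le_trans (det_swap u pA ws) _.
  apply: (@le_trans _ _ (sup E)); last by lra.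
  apply: sup_upper_bound => //; exists (u :: rem w s); split=> //.
    by rewrite /= size_rem // sn prednK // muln_gt0.
  by move=> z; rewrite inE => /predU1P[->//|/mem_rem/sG].
exists s; split=> // u v Gu; apply: le_trans (dot_cauchy_schwarz u v pA) _.
rewrite ler_wpM2r ?posdef_ge0 //.
have : \sum_(w <- s) (1 + qf (invmx (second_moment s)) u u) *
    (1 - qf (invmx (second_moment s)) w w) <= \sum_(w <- s) (3 / 2).
  by rewrite big_seq [leRHS]big_seq ler_sum // => w ws; exact: swap.
rewrite -mulr_sumr sumrB sum_leverage ?posdef_unit //.
rewrite !big_const_seq !count_predT !iter_addr !addr0 sn.
rewrite -[3 / 2 *+ _]mulr_natr !natrM => h.
have nR : 0 < n%:R :> R by rewrite ltr0n.
rewrite -(ler_pM2r nR); lra.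
Qed.
End NearlyOptimalDesign.

(** * From complex to real forms *)

Section ComplexNorm.
Variable R : realType.
Implicit Types z w : R[i].

Lemma normc_ge0 z : 0 <= Normc.normc z.
Proof. by case: z => *; exact: sqrtr_ge0. Qed.

Lemma sqr_normcE z :
  Normc.normc z ^+ 2 = complex.Re z ^+ 2 + complex.Im z ^+ 2.
Proof. by case: z => p q /=; rewrite sqr_sqrtr ?addr_ge0 ?sqr_ge0. Qed.

Lemma normRe_le z : `|complex.Re z| <= Normc.normc z.
Proof.
by case: z => p q /=; rewrite -sqrtr_sqr ler_wsqrtr // lerDl sqr_ge0.
Qed.

Lemma normIm_le z : `|complex.Im z| <= Normc.normc z.
Proof.
by case: z => p q /=; rewrite -sqrtr_sqr ler_wsqrtr // lerDr sqr_ge0.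
Qed.

Lemma sqr_normcD z w :
  Normc.normc (z + w) ^+ 2 <= 2 * Normc.normc z ^+ 2 + 2 * Normc.normc w ^+ 2.
Proof.
rewrite !sqr_normcE; case: z w => [p q] [r s] /=; rewrite -subr_ge0.
have -> : 2 * (p ^+ 2 + q ^+ 2) + 2 * (r ^+ 2 + s ^+ 2) - ((p + r) ^+ 2 + (q + s) ^+ 2) =
  (p - r) ^+ 2 + (q - s) ^+ 2 by ring.
by rewrite addr_ge0 ?sqr_ge0.
Qed.

Lemma normc_opp z : Normc.normc (- z) = Normc.normc z.
Proof. by case: z => p q /=; rewrite !sqrrN. Qed.
End ComplexNorm.

Section RealForms.
Variables (R : realType) (N : nat).
Implicit Types z a : 'rV[R[i]]_N.

(** The real linear forms on R^(2N) that give the real and the imaginary part of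
    [pairing a z] in terms of [real_coords a]. *)
Definition re_form z : 'rV[R]_(N + N) :=
  row_mx (map_mx (@complex.Re R) z) (- map_mx (@complex.Im R) z).
Definition im_form z : 'rV[R]_(N + N) :=
  row_mx (map_mx (@complex.Im R) z) (map_mx (@complex.Re R) z).
Definition real_coords a : 'rV[R]_(N + N) :=
  row_mx (map_mx (@complex.Re R) a) (map_mx (@complex.Im R) a).

Definition pairing a z : R[i] := \sum_(i < N) a 0 i * z 0 i.

Lemma Re_sum I (s : seq I) (F : I -> R[i]) :
  complex.Re (\sum_(i <- s) F i) = \sum_(i <- s) complex.Re (F i).
Proof. by elim/big_rec2: _ => // i x y _ <-; case: (F i); case: y. Qed.

Lemma Im_sum I (s : seq I) (F : I -> R[i]) :
  complex.Im (\sum_(i <- s) F i) = \sum_(i <- s) complex.Im (F i).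
Proof. by elim/big_rec2: _ => // i x y _ <-; case: (F i); case: y. Qed.

Lemma re_formE z a : qf 1%:M (re_form z) (real_coords a) = complex.Re (pairing a z).
Proof.
rewrite /qf mulmx1 /re_form /real_coords tr_row_mx mul_row_col mxE /pairing Re_sum.
rewrite !mxE -big_split /=; apply: eq_bigr => i _; rewrite !mxE.
by case: (z 0 i) => p q; case: (a 0 i) => r s /=; ring.
Qed.

Lemma im_formE z a : qf 1%:M (im_form z) (real_coords a) = complex.Im (pairing a z).
Proof.
rewrite /qf mulmx1 /im_form /real_coords tr_row_mx mul_row_col mxE /pairing Im_sum.
rewrite !mxE -big_split /=; apply: eq_bigr => i _; rewrite !mxE.
by case: (z 0 i) => p q; case: (a 0 i) => r s /=; ring.
Qed.

Lemma real_coords_surj v : exists a, real_coords a = v.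
Proof.
exists (\row_i Complex (v 0 (lshift N i)) (v 0 (rshift N i))).
apply/rowP => j; case: (split_ordP j) => k ->.
  by rewrite row_mxEl !mxE.
by rewrite row_mxEr !mxE.
Qed.
End RealForms.

(** * Sampling points and stable recovery *)

(** [e x] lists the values at [x] of a basis of the space, and [pairing a (e x)]
    is the value at [x] of the element with coefficients [a].  The matrix [G]
    stands for the integral over [Om] of the second moments of [re_form] and
    [im_form] together, a measure of total mass 2. *)
Section SamplingPoints.
Variables (R : realType) (N : nat) (T : Type) (Om : set T) (e : T -> 'rV[R[i]]_N).
Variables (b : R) (G : 'M[R]_(N + N)).
Hypothesis N_gt0 : (0 < N)%N.
Hypothesis e_bounded : forall x i, Om x -> Normc.normc (e x 0 i) <= b.
Hypothesis e_free : forall a, (forall x, Om x -> pairing a (e x) = 0) -> a = 0.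
Hypothesis G_sym : G^T = G.
Hypothesis G_average : forall (V : 'M[R]_(N + N)) (c : R),
  (forall x, Om x -> qf V (re_form (e x)) (re_form (e x)) +
                     qf V (im_form (e x)) (im_form (e x)) <= c) ->
  \tr (V *m G) <= c.

Theorem sampling_points : exists x : 'I_(4 * (N + N)) -> T,
  [/\ forall j, Om (x j),
      forall a, qf G (real_coords a) (real_coords a) <=
        3 / (N + N)%:R * \sum_j Normc.normc (pairing a (e (x j))) ^+ 2 &
      forall a y, Om y -> Normc.normc (pairing a (e y)) ^+ 2 <=
        24 * \sum_j Normc.normc (pairing a (e (x j))) ^+ 2].
Proof.
set n := (N + N)%N; have n0 : (0 < n)%N by rewrite addn_gt0 N_gt0.
have nR : 0 < n%:R :> R by rewrite ltr0n.
pose Gam : set 'rV[R]_n :=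
  [set u | exists2 x, Om x & u = re_form (e x) \/ u = im_form (e x)].
have reG x : Om x -> Gam (re_form (e x)) by exists x => //; left.
have imG x : Om x -> Gam (im_form (e x)) by exists x => //; right.
have GamB u i : Gam u -> `|u 0 i| <= b.
  case=> x Ox []->; case: (split_ordP i) => k ->;
    rewrite ?row_mxEl ?row_mxEr !mxE ?normrN;
    by apply: le_trans (e_bounded k Ox); rewrite ?normRe_le ?normIm_le.
have GamS (v : 'rV[R]_n) : (forall u, Gam u -> qf 1%:M u v = 0) -> v = 0.
  have [a <-] := real_coords_surj v => av.
  rewrite (e_free (a := a)); first by apply/rowP => j; case: (split_ordP j) => k ->;
    rewrite /real_coords ?row_mxEl ?row_mxEr !mxE.
  move=> x Ox; have := av _ (reG x Ox); have := av _ (imG x Ox).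
  by rewrite re_formE im_formE; case: pairing => p q /= -> ->.
have [s [sn sG pA sS]] := near_optimal_sample GamB GamS n0.
(* Probability average of the three unit masses: real forms, imaginary forms, and
   the design points. *)
pose G1 := 3^-1 *: (G + (2 * n)%:R^-1 *: second_moment s).
have n2 : 0 < (2 * n)%:R :> R by rewrite ltr0n muln_gt0.
have G0 v : 0 <= qf G v v.
  rewrite -oppr_le0 qf_trace mxtrace_mulC -raddfN /= -mulNmx; apply: G_average => x Ox.
  by rewrite !qfN -opprD oppr_le0 addr_ge0 // qf_rank1_ge0.
have pG1 : posdef G1.
  apply: posdefZ => //; split; first by rewrite linearD linearZ /= (posdef_sym pA) G_sym.
  move=> v v0; rewrite qfD ltr_wpDl // qfZ mulr_gt0 ?invr_gt0 //; exact: pA.2.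
have avG1 V c : (forall u, Gam u -> qf V u u <= c) -> \tr (V *m G1) <= c.
  move=> Vc; rewrite -scalemxAr mxtraceZ mulmxDr mxtraceD -scalemxAr mxtraceZ.
  have h1 : \tr (V *m G) <= c + c.
    by apply: G_average => x Ox; apply: lerD; apply: Vc; [exact: reG|exact: imG].
  have h2 : (2 * n)%:R^-1 * \tr (V *m second_moment s) <= c.
    rewrite ler_pdivrMl // /second_moment mulmx_sumr raddf_sum /=.
    under eq_bigr do rewrite -qf_trace.
    rewrite -sn -sum1_size natr_sum mulr_suml big_seq [leRHS]big_seq.
    by apply: ler_sum => w ws; rewrite mul1r; apply: Vc; exact: sG.
  lra.
have [t [tn tG tF]] := lower_frame pG1 avG1 n0.
pose tj (j : 'I_(4 * n)) := tnth (in_tuple t) (cast_ord (esym tn) j).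
have /choice[x xP] : forall j, exists y,
    Om y /\ (tj j = re_form (e y) \/ tj j = im_form (e y)).
  by move=> j; have [y Oy yj] := tG _ (mem_tnth (cast_ord (esym tn) j) (in_tuple t)); exists y.
have key a : qf G1 (real_coords a) (real_coords a) <=
    n%:R^-1 * \sum_j Normc.normc (pairing a (e (x j))) ^+ 2.
  apply: le_trans (tF _) _; rewrite ler_wpM2l ?invr_ge0 //.
  rewrite qf_second_moment big_tnth (reindex (cast_ord (esym tn))) /=; last first.
    by exists (cast_ord tn) => j _; rewrite ?cast_ordK ?cast_ordKV.
  apply: ler_sum => j _; rewrite sqr_normcE -/(tj j); have [_ []->] := xP j.
    by rewrite re_formE lerDl sqr_ge0.
  by rewrite im_formE lerDr sqr_ge0.
exists x; split=> [j|a|a y Oy]; first by case: (xP j).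
  have := key a; rewrite qfZ qfD qfZ.
  have : 0 <= (2 * n)%:R^-1 * qf (second_moment s) (real_coords a) (real_coords a).
    by apply: mulr_ge0; [rewrite invr_ge0|exact: posdef_ge0].
  by rewrite -mulrA; lra.
set S := \sum_j _.
have : qf (second_moment s) (real_coords a) (real_coords a) <= 6 * S.
  have := key a; rewrite qfZ qfD qfZ -/S natrM invfM.
  have := G0 (real_coords a); set p := qf G _ _; set q := qf _ _ _ => p0 h.
  have : n%:R^-1 * q <= n%:R^-1 * (6 * S) by lra.
  by rewrite ler_pM2l // invr_gt0.
rewrite sqr_normcE -re_formE -im_formE.
have := sS _ (real_coords a) (reG y Oy); have := sS _ (real_coords a) (imG y Oy).
lra.
Qed.
End SamplingPoints.

Section LeastSquares.
Variables (C : numClosedFieldType).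

Let adj m n (A : 'M[C]_(m, n)) : 'M[C]_(n, m) := map_mx (@Num.conj C) A^T.

Let adjM m n p (A : 'M[C]_(m, n)) (B : 'M[C]_(n, p)) : adj (A *m B) = adj B *m adj A.
Proof. by rewrite /adj trmx_mul map_mxM. Qed.

Let adjK m n (A : 'M[C]_(m, n)) : adj (adj A) = A.
Proof. by apply/matrixP => i j; rewrite !mxE conjCK. Qed.

Let sqnormE k (v : 'rV[C]_k) : (v *m adj v) 0 0 = \sum_j `|v 0 j| ^+ 2.
Proof. by rewrite mxE; apply: eq_bigr => j _; rewrite !mxE normCK. Qed.

(** The map v |-> v L B is the orthogonal projection onto the row space of [B],
    and therefore a contraction. *)
Lemma least_squares N k (B : 'M[C]_(N, k)) : row_free B ->
  exists L : 'M[C]_(k, N), B *m L = 1%:M /\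
    forall v : 'rV_k, \sum_j `|(v *m L *m B) 0 j| ^+ 2 <= \sum_j `|v 0 j| ^+ 2.
Proof.
move=> fB.
have uG : B *m adj B \in unitmx.
  rewrite -row_free_unit -kermx_eq0; apply/rowV0P => v /sub_kermxP vG.
  have : ((v *m B) *m adj (v *m B)) 0 0 = 0.
    by rewrite adjM mulmxA -(mulmxA v) vG mul0mx mxE.
  rewrite sqnormE => /eqP; rewrite psumr_eq0 => [|j _]; last by rewrite exprn_ge0.
  move=> /allP vB; apply: (row_free_inj fB); rewrite mul0mx.
  apply/matrixP => i j; rewrite ord1 [RHS]mxE.
  have := vB j; rewrite mem_index_enum => /(_ isT).
  by rewrite /= expf_eq0 normr_eq0 => /andP[_ /eqP].
exists (adj B *m invmx (B *m adj B)); split; first by rewrite mulmxA mulmxV.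
move=> v; set w := v *m _ *m B; pose r := v - w.
have rB : r *m adj B = 0.
  by rewrite /r /w mulmxBl mulmxA -!mulmxA mulVmx // mulmx1 subrr.
have rw : r *m adj w = 0 by rewrite /w adjM mulmxA rB mul0mx.
have wr : w *m adj r = 0.
  by rewrite -[LHS]adjK adjM adjK rw; apply/matrixP => i j; rewrite !mxE conjC0.
rewrite -!sqnormE -[v in leRHS](subrK w) -/r.
have -> : adj (r + w) = adj r + adj w.
  by apply/matrixP => i j; rewrite !mxE rmorphD.
rewrite mulmxDl !mulmxDr rw wr addr0 add0r [leRHS]mxE lerDr sqnormE.
by rewrite sumr_ge0 // => j _; rewrite exprn_ge0.
Qed.
End LeastSquares.

Section Recovery.
Variables (R : realType) (N : nat) (T : choiceType) (Om : set T) (e : T -> 'rV[R[i]]_N).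
Variables (b : R) (G : 'M[R]_(N + N)).
Hypothesis N_gt0 : (0 < N)%N.
Hypothesis e_bounded : forall x i, Om x -> Normc.normc (e x 0 i) <= b.
Hypothesis e_free : forall a, (forall x, Om x -> pairing a (e x) = 0) -> a = 0.
Hypothesis G_sym : G^T = G.
Hypothesis G_average : forall (V : 'M[R]_(N + N)) (c : R),
  (forall x, Om x -> qf V (re_form (e x)) (re_form (e x)) +
                     qf V (im_form (e x)) (im_form (e x)) <= c) ->
  \tr (V *m G) <= c.

(** Least squares at the points of [sampling_points]: the discrete norm of the
    recovered function is at most 8 N E^2, and the two frame inequalities turn
    this into 12 E^2 and 192 N E^2. *)
Theorem stable_recovery : exists (k : nat) (x : 'I_k -> T) (L : 'rV[R[i]]_k -> 'rV[R[i]]_N),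
  [/\ [/\ (k <= 8 * N)%N, injective x & forall j, Om (x j)],
      forall (c : R[i]) v w, L (c *: v + w) = c *: L v + L w,
      forall a, L (\row_j pairing a (e (x j))) = a,
      forall (v : 'rV[R[i]]_k) E, (forall j, Normc.normc (v 0 j) <= E) ->
        qf G (real_coords (L v)) (real_coords (L v)) <= 12 * E ^+ 2 &
      forall (v : 'rV[R[i]]_k) E y, (forall j, Normc.normc (v 0 j) <= E) -> Om y ->
        Normc.normc (pairing (L v) (e y)) ^+ 2 <= 192 * N%:R * E ^+ 2].
Proof.
have [x [xOm xG xsup]] := sampling_points N_gt0 e_bounded e_free G_sym G_average.
pose B : 'M[R[i]]_(N, 4 * (N + N)) := \matrix_(i, j) e (x j) 0 i.
have BE a j : (a *m B) 0 j = pairing a (e (x j)).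
  by rewrite mxE; apply: eq_bigr => i _; rewrite mxE.
have fB : row_free B.
  rewrite -kermx_eq0; apply/eqP/row_matrixP => i; rewrite row0.
  have : row i (kermx B) *m B = 0 by rewrite -row_mul mulmx_ker row0.
  move: (row i _) => a aB; apply: e_free => y Oy; apply: Normc.eq0_normc.
  have := xsup a y Oy; rewrite big1 => [|j _]; last first.
    by rewrite -BE aB mxE Normc.normc0 expr0n.
  by rewrite mulr0 => h; apply/eqP; rewrite -sqrf_eq0 eq_le h sqr_ge0.
have [L [BL Lc]] := least_squares fB.
have LE (v : 'rV[R[i]]_(4 * (N + N))) E : (forall j, Normc.normc (v 0 j) <= E) ->
    \sum_j Normc.normc (pairing (v *m L) (e (x j))) ^+ 2 <= (8 * N)%:R * E ^+ 2.
  move=> vE; apply: (@le_trans _ _ (\sum_j Normc.normc (v 0 j) ^+ 2)).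
    rewrite -lecR !rmorph_sum /=.
    under eq_bigr do rewrite -BE rmorphXn.
    under [leRHS]eq_bigr do rewrite rmorphXn.
    exact: Lc.
  apply: (@le_trans _ _ (\sum_(j < 4 * (N + N)) E ^+ 2)).
    by apply: ler_sum => j _; rewrite lerXn2r ?nnegrE ?(le_trans _ (vE j)) //;
      exact: normc_ge0.
  rewrite sumr_const card_ord -[leLHS]mulr_natl.
  by rewrite (_ : 4 * (N + N) = 8 * N)%N; last lia.
(* The points may repeat; the data at distinct points is copied to each of its
   occurrences before least squares is applied. *)
pose s := undup (codom x).
have xs j : x j \in s by rewrite mem_undup codom_f.
pose z (j : 'I_(size s)) := tnth (in_tuple s) j.
have /choice[sg zsg] : forall j, exists i, z i = x j.
  by move=> j; have /tnthP[i ->] : x j \in in_tuple s by []; exists i.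
pose spread (v : 'rV[R[i]]_(size s)) := \row_j v 0 (sg j).
exists (size s), z, (fun v => spread v *m L); split.
- split.
  + rewrite (leq_trans (size_undup _)) // size_codom card_ord; lia.
  + move=> i j; rewrite /z !(tnth_nth (z i)) => /eqP.
    by rewrite nth_uniq ?undup_uniq // => /eqP/val_inj.
  + move=> j; have : z j \in codom x by rewrite -mem_undup mem_tnth.
    by case/mapP => i _ ->.
- move=> c v w; rewrite scalemxAl -mulmxDl; congr (_ *m L).
  by apply/rowP => j; rewrite !mxE.
- move=> a; rewrite -[RHS]mulmx1 -BL mulmxA; congr (_ *m L).
  by apply/rowP => j; rewrite BE !mxE zsg.
- move=> v E vE; apply: le_trans (xG _) _.
  have := LE (spread v) E; set S := \sum_j _ => h.
  have NR : 0 < N%:R :> R by rewrite ltr0n.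
  have {}h : S <= (8 * N)%:R * E ^+ 2 by apply: h => j; rewrite mxE.
  rewrite mulrAC ler_pdivrMr ?ltr0n ?addn_gt0 ?N_gt0 // natrD.
  by move: h; rewrite natrM; lra.
- move=> v E y vE Oy; apply: le_trans (xsup _ _ Oy) _.
  have := LE (spread v) E; set S := \sum_j _ => h.
  have {}h : S <= (8 * N)%:R * E ^+ 2 by apply: h => j; rewrite mxE.
  by move: h; rewrite natrM; lra.
Qed.
End Recovery.

(** * Continuous functions on a compact set and their Gram matrix *)

Section ContinuousOnCompact.
Variable R : realType.

(** The topology of the complex numbers is given by balls with complex radii; a
    real radius serves after embedding it. *)
Lemma lipschitz_normc_continuous (h : R.-C -> R) :
  (forall z w, `|h z - h w| <= Normc.normc (z - w : R[i])) -> continuous h.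
Proof.
move=> hL z; apply/(@cvgrPdist_lt _ _ _ _ (nbhs_filter (z : R.-C))) => eps e0.
have e0' : 0 < (real_complex R eps : R.-C) by rewrite ltcR.
apply/nbhs_ballP; exists (real_complex R eps) => //= w.
by rewrite -ball_normE /= ltcR => zw; apply: le_lt_trans zw; exact: hL.
Qed.

Lemma continuous_Re : continuous (fun z : R.-C => complex.Re z).
Proof.
apply: lipschitz_normc_continuous => z w.
by apply: le_trans (normRe_le _); case: z w => [p q] [r s].
Qed.

Lemma continuous_Im : continuous (fun z : R.-C => complex.Im z).
Proof.
apply: lipschitz_normc_continuous => z w.
by apply: le_trans (normIm_le _); case: z w => [p q] [r s].
Qed.

Lemma within_measurable (T U : ptopologicalType) (D : set T) (f : T -> U) :
  measurable (D : set (borel T)) -> {within D, continuous f} ->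
  measurable_fun (D : set (borel T)) (f : borel T -> borel U).
Proof.
move=> mD /continuousP cf; apply: (@measurability _ _ (borel T) (borel U) D f (@open U)) => //.
move=> _ [V oV <-]; have /open_subspaceP[W oW WV] := cf V oV.
rewrite setIC -WV; apply: measurableI => //.
exact: sub_sigma_algebra.
Qed.

Lemma within_measurable_real (T : ptopologicalType) (D : set T) (f : T -> R) :
  measurable (D : set (borel T)) -> {within D, continuous f} ->
  measurable_fun (D : set (borel T)) (f : borel T -> R).
Proof.
move=> mD /continuousP cf; apply: (measurability _ (measurable_realfun.RGenOpens.measurableE R)).
move=> _ [_ [a [b ->] <-]].
have /cf/open_subspaceP[W oW WV] : open `]a, b[%classic by exact: interval_open.
rewrite setIC -WV; apply: measurableI => //.
exact: sub_sigma_algebra.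
Qed.

Lemma compact_borel_measurable d (D : set 'rV[R]_d) : compact D ->
  measurable (D : set (borel 'rV[R]_d)).
Proof.
move=> cD; rewrite -[D]setCK; apply: measurableC; apply: sub_sigma_algebra.
by apply: closed_openC; apply: compact_closed cD; exact: norm_hausdorff.
Qed.

Lemma within_bounded d (D : set 'rV[R]_d) (f : 'rV[R]_d -> R) :
  compact D -> {within D, continuous f} -> exists2 M, 0 <= M & forall x, D x -> `|f x| <= M.
Proof.
move=> cD cf; have /compact_bounded[M [_ hM]] := continuous_compact cf cD.
exists (`|M| + 1); first by rewrite addr_ge0.
move=> x Dx; apply: (hM (`|M| + 1)); last by exists x.
by apply: le_lt_trans (ler_norm M) _; rewrite ltrDl.
Qed.
End ContinuousOnCompact.

Section GramMatrix.
Variables (R : realType) (d : nat) (Om : set 'rV[R]_d).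
Variable mu : probability (borel 'rV[R]_d) R.
Hypotheses (Om_compact : compact Om) (mu_Om : mu Om = 1%E).
Implicit Types h : 'rV[R]_d -> R.

Lemma continuous_on_integrable h : {within Om, continuous h} ->
  mu.-integrable (Om : set (borel 'rV[R]_d)) (EFin \o h).
Proof.
move=> ch; have mOm := compact_borel_measurable Om_compact.
have muy : (mu Om < +oo)%E by rewrite mu_Om ltry.
apply: measurable_bounded_integrable => //.
  exact: within_measurable_real.
have [M M0 hM] := within_bounded Om_compact ch.
exists M; split; first exact: num_real.
by move=> y My x /hM; move/le_trans; apply; exact: ltW.
Qed.

Lemma continuous_on_sum I (s : seq I) (F : I -> 'rV[R]_d -> R) :
  (forall i, {within Om, continuous F i}) ->
  {within Om, continuous (fun x => \sum_(i <- s) F i x)}.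
Proof.
move=> cF; elim: s => [|i s IHs].
  by under eq_fun do rewrite big_nil; move=> x; exact: cvg_cst.
under eq_fun do rewrite big_cons.
by move=> x; apply: cvgD; [exact: cF|exact: IHs].
Qed.

Lemma Rintegral_sum I (s : seq I) (F : I -> 'rV[R]_d -> R) :
  (forall i, {within Om, continuous F i}) ->
  \int[mu]_(x in Om) (\sum_(i <- s) F i x) = \sum_(i <- s) \int[mu]_(x in Om) F i x.
Proof.
move=> cF; have mOm := compact_borel_measurable Om_compact.
elim: s => [|i s IHs].
  under eq_Rintegral do rewrite big_nil.
  by rewrite Rintegral_cst // mul0r big_nil.
under eq_Rintegral do rewrite big_cons.
rewrite RintegralD ?IHs ?big_cons //; apply: continuous_on_integrable => //.
exact: continuous_on_sum.
Qed.

Lemma qf_expand n (V : 'M[R]_n) u v :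
  qf V u v = \sum_i \sum_j V i j * (u 0 i * v 0 j).
Proof.
rewrite /qf mxE exchange_big /=; apply: eq_bigr => j _.
by rewrite mxE !mxE mulr_suml; apply: eq_bigr => i _; rewrite mulrCA mulrA.
Qed.

Variables (n : nat) (r s : 'rV[R]_d -> 'rV[R]_n).
Hypothesis r_cont : forall i, {within Om, continuous (fun x => r x 0 i)}.
Hypothesis s_cont : forall i, {within Om, continuous (fun x => s x 0 i)}.

(** Two families [r] and [s] occur because real and imaginary parts contribute
    separately to |u|^2. *)
Definition gram_matrix : 'M[R]_n := \matrix_(i, j)
  (\int[mu]_(x in Om) (r x 0 i * r x 0 j + s x 0 i * s x 0 j)).

Lemma gram_matrix_sym : gram_matrix^T = gram_matrix.
Proof.
apply/matrixP => i j; rewrite !mxE; apply: eq_Rintegral => x _.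
by rewrite mulrC [s x 0 j * _]mulrC.
Qed.

Let cont1 i j :
  {within Om, continuous (fun x => r x 0 i * r x 0 j + s x 0 i * s x 0 j)}.
Proof.
move=> x; apply: cvgD; apply: cvgM;
  [exact: r_cont|exact: r_cont|exact: s_cont|exact: s_cont].
Qed.

Let term (V : 'M[R]_n) (p : 'I_n * 'I_n) x :=
  V p.1 p.2 * (r x 0 p.1 * r x 0 p.2 + s x 0 p.1 * s x 0 p.2).

Let term_cont V p : {within Om, continuous (term V p)}.
Proof. by move=> x; apply: cvgM; [exact: cvg_cst|exact: cont1]. Qed.

Let qf_term V x : qf V (r x) (r x) + qf V (s x) (s x) = \sum_p term V p x.
Proof.
rewrite !qf_expand -big_split /= -(pair_bigA _ (fun i j => term V (i, j) x)) /=.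
apply: eq_bigr => i _; rewrite -big_split /=.
by apply: eq_bigr => j _; rewrite /term /= mulrDr.
Qed.

Lemma qf_continuous V :
  {within Om, continuous (fun x => qf V (r x) (r x) + qf V (s x) (s x))}.
Proof.
under eq_fun do rewrite qf_term; apply: continuous_on_sum; exact: term_cont.
Qed.

(** The trace pairing with the Gram matrix is integration of the quadratic form;
    applied to V = v^T v and to general V it gives the integral of |u|^2 and the
    averaging property of the lower frame theorem. *)
Lemma trace_gram_matrix V : \tr (V *m gram_matrix) =
  \int[mu]_(x in Om) (qf V (r x) (r x) + qf V (s x) (s x)).
Proof.
have mOm := compact_borel_measurable Om_compact.
under eq_Rintegral do rewrite qf_term.
rewrite (Rintegral_sum _ (@term_cont V)).
rewrite -(pair_bigA _ (fun i j => \int[mu]_(x in Om) term V (i, j) x)) /= /mxtrace.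
apply: eq_bigr => i _; rewrite mxE; apply: eq_bigr => j _; rewrite mxE.
rewrite -RintegralZl //; last exact: continuous_on_integrable (@cont1 j i).
by apply: eq_Rintegral => x _; rewrite /term /=; ring.
Qed.
End GramMatrix.

(** * Growth of Phi *)

Section PhiGrowth.
Variables (R : realType) (Phi : R -> R) (p a : R).
Hypotheses (p_ge2 : 2 <= p) (Phi_fun : Phi_function Phi).
Hypotheses (aPhi : aInc_with Phi p a) (Phi1_gt0 : 0 < Phi 1).

Lemma aInc_ratio s t : 0 < s -> s <= t -> Phi s <= a * (s / t) `^ p * Phi t.
Proof.
move=> s0 st; have t0 := lt_le_trans s0 st.
case: aPhi => a1 ha; move: st; rewrite le_eqVlt => /predU1P[<-|st].
  rewrite divff ?gt_eqF // powR1 mulr1 ler_peMl //.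
  by apply: (Phi_nonneg Phi_fun); exact: ltW.
have -> : (s / t) `^ p = s `^ p * t `^ (- p).
  by rewrite powRM ?invr_ge0 ?ltW // -powR_inv1 ?ltW // -powRrM mulN1r.
have := ha s t s0 st; rewrite powRN ler_pdivrMr ?powR_gt0 // => h.
by apply: le_trans h _; rewrite le_eqVlt; apply/orP; left; apply/eqP; ring.
Qed.

Variable N : nat.
Hypothesis N_gt0 : (0 < N)%N.

(** The constant (Phi(sqrt N) / N)^(1/p) of the theorem with its prefactor,
    collected under one power. *)
Definition growth_factor : R :=
  (a ^+ 2 * (1 + (Phi 1)^-1) * (Phi (Num.sqrt N%:R) / N%:R)) `^ p^-1.

Let NR : 0 < N%:R :> R. Proof. by rewrite ltr0n. Qed.
Let sqrtN_ge1 : 1 <= Num.sqrt N%:R :> R.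
Proof. by rewrite -[leLHS]sqrtr1 ler_wsqrtr // ler1n. Qed.

Lemma Phi_sqrtN_gt0 : 0 < Phi (Num.sqrt N%:R).
Proof.
by apply: lt_le_trans Phi1_gt0 _; apply: (Phi_increasing Phi_fun).
Qed.

Let sqr_powR_le x : 0 <= x -> x <= 1 -> x `^ p <= x ^+ 2.
Proof.
rewrite le_eqVlt => /predU1P[<-|x0] x1.
  by rewrite powR0 ?expr0n // gt_eqF // (lt_le_trans _ p_ge2).
by rewrite -powR_mulrn ?(ltW x0) //; apply: ger_powR; rewrite ?x0.
Qed.

Lemma growth_factor_powR : growth_factor `^ p =
  a ^+ 2 * (1 + (Phi 1)^-1) * (Phi (Num.sqrt N%:R) / N%:R).
Proof.
have P0 := Phi_sqrtN_gt0.
rewrite /growth_factor -powRrM mulVf ?gt_eqF ?(lt_le_trans _ p_ge2) // powRr1 //.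
rewrite mulr_ge0 ?divr_ge0 ?ltW // mulr_gt0 ?addr_gt0 ?invr_gt0 //.
by rewrite exprn_gt0 // (lt_le_trans ltr01) //; case: aPhi.
Qed.

(** Comparing Phi at 1 and at sqrt N gives Phi(1) <= a Phi(sqrt N) / N. *)
Lemma growth_factor_ge1 : 1 <= growth_factor.
Proof.
have P0 := Phi_sqrtN_gt0; have a1 : 1 <= a by case: aPhi.
have := aInc_ratio ltr01 sqrtN_ge1; rewrite div1r => h.
have {h} : Phi 1 <= a * N%:R^-1 * Phi (Num.sqrt N%:R).
  apply: le_trans h _; rewrite (ler_wpM2r (ltW P0)) // ler_wpM2l ?(le_trans ler01 a1) //.
  have /sqr_powR_le : 0 <= (Num.sqrt N%:R)^-1 :> R by rewrite invr_ge0 sqrtr_ge0.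
  by rewrite exprVn sqr_sqrtr ?ler0n //; apply; rewrite invf_le1 // (lt_le_trans ltr01).
rewrite mulrAC -mulrA => h.
rewrite -[leLHS](congr1 (fun f => f p^-1) (powR1 R)) ge0_ler_powR ?nnegrE ?invr_ge0 //.
- by rewrite (le_trans _ p_ge2).
- by rewrite -growth_factor_powR powR_ge0.
rewrite expr2 -!mulrA; set y := Phi _ / _ in h *.
have : Phi 1 * (1 + (Phi 1)^-1) <= a * y * (1 + (Phi 1)^-1).
  by rewrite ler_wpM2r // addr_ge0 // invr_ge0 ltW.
rewrite mulrDr mulfV ?gt_eqF // mulr1 => h'.
have h2 : 1 <= a * y * (1 + (Phi 1)^-1) by apply: le_trans h'; rewrite lerDr ltW.
apply: (le_trans h2).
rewrite (_ : a * (a * _) = a * (a * y * (1 + (Phi 1)^-1))); last by ring.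
by rewrite ler_peMl // (le_trans _ h2).
Qed.

(** Comparing Phi at t / M and at sqrt N gives
    Phi(t / M) <= a M^-p (t / sqrt N)^p Phi(sqrt N); the power p may be replaced
    by 2 as t <= sqrt N, and the choice of M^p absorbs all other factors. *)
Lemma Phi_le_sqr t : 0 <= t -> t <= Num.sqrt N%:R ->
  Phi (t / growth_factor) <= t ^+ 2.
Proof.
have M1 := growth_factor_ge1; have M0 := lt_le_trans ltr01 M1.
have P0 := Phi_sqrtN_gt0; have a1 : 1 <= a by case: aPhi.
have a0 := lt_le_trans ltr01 a1.
rewrite le_eqVlt => /predU1P[<-|t0] tN.
  by rewrite mul0r (Phi_zero Phi_fun) expr0n.
have tM0 : 0 < t / growth_factor by rewrite divr_gt0.
have tM : t / growth_factor <= Num.sqrt N%:R.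
  by rewrite ler_pdivrMr // (le_trans tN) // ler_peMr // sqrtr_ge0.
apply: le_trans (aInc_ratio tM0 tM) _.
have -> : t / growth_factor / Num.sqrt N%:R = (t / Num.sqrt N%:R) * growth_factor^-1.
  by rewrite mulrAC.
have sN0 : 0 < Num.sqrt N%:R :> R by rewrite sqrtr_gt0.
rewrite powRM ?invr_ge0 ?divr_ge0 ?(ltW M0) ?(ltW t0) ?(ltW sN0) //.
rewrite -(powR_inv1 (ltW M0)) -powRrM mulN1r powRN growth_factor_powR.
apply: (@le_trans _ _ (a * ((t / Num.sqrt N%:R) ^+ 2 *
  (a ^+ 2 * (1 + (Phi 1)^-1) * (Phi (Num.sqrt N%:R) / N%:R))^-1) * Phi (Num.sqrt N%:R))).
  rewrite (ler_wpM2r (ltW P0)) // (ler_wpM2l (ltW a0)) // ler_wpM2r ?sqr_powR_le //.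
  - by rewrite invr_ge0 -growth_factor_powR powR_ge0.
  - by rewrite divr_ge0 ?ltW.
  - by rewrite ler_pdivrMr // mul1r.
rewrite expr_div_n sqr_sqrtr ?ler0n //.
have q0 : 0 < 1 + (Phi 1)^-1 by rewrite addr_gt0 // invr_gt0.
have -> : a * (t ^+ 2 / N%:R * (a ^+ 2 * (1 + (Phi 1)^-1) * (Phi (Num.sqrt N%:R) / N%:R))^-1) *
   Phi (Num.sqrt N%:R) = t ^+ 2 * (a * (1 + (Phi 1)^-1))^-1.
  move: q0; set q := 1 + _ => q0; field.
  by rewrite !gt_eqF //.
rewrite ler_piMr ?sqr_ge0 // invf_le1; last by rewrite mulr_gt0.
by rewrite (le_trans a1) // ler_peMr ?ltW // ltrDl invr_gt0.
Qed.
End PhiGrowth.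

(** * Recovery in a space of continuous functions *)

Section SpaceRecovery.
Variables (R : realType) (d : nat) (Om : set 'rV[R]_d).
Variable mu : probability (borel 'rV[R]_d) R.
Hypotheses (Om_compact : compact Om) (mu_Om : mu Om = 1%E).

Lemma C_on_Re (f : 'rV[R]_d -> R.-C) : C_on Om f ->
  {within Om, continuous (fun x => complex.Re (f x))}.
Proof. by move=> cf x; apply: (cvg_comp _ _ (cf x)); exact: continuous_Re. Qed.

Lemma C_on_Im (f : 'rV[R]_d -> R.-C) : C_on Om f ->
  {within Om, continuous (fun x => complex.Im (f x))}.
Proof. by move=> cf x; apply: (cvg_comp _ _ (cf x)); exact: continuous_Im. Qed.

Lemma C_on_sqr_normc (f : 'rV[R]_d -> R.-C) : C_on Om f ->
  {within Om, continuous (fun x => Normc.normc (f x) ^+ 2)}.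
Proof.
move=> cf.
have -> : (fun x => Normc.normc (f x) ^+ 2) =
    (fun x => complex.Re (f x) * complex.Re (f x) + complex.Im (f x) * complex.Im (f x)).
  by apply/funext => x; rewrite sqr_normcE !expr2.
have cR := C_on_Re cf; have cI := C_on_Im cf.
by move=> x; apply: cvgD; apply: cvgM; [exact: cR|exact: cR|exact: cI|exact: cI].
Qed.

Lemma C_on_bounded (f : 'rV[R]_d -> R.-C) : C_on Om f ->
  exists2 M, 0 <= M & forall x, Om x -> Normc.normc (f x) <= M.
Proof.
move=> cf; have [M M0 hM] := within_bounded Om_compact (C_on_sqr_normc cf).
exists (Num.sqrt M) => [|x Ox]; first exact: sqrtr_ge0.
rewrite -[leLHS](ger0_norm (normc_ge0 _)) -sqrtr_sqr ler_wsqrtr //.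
exact: le_trans (ler_norm _) (hM x Ox).
Qed.

Variables (N : nat) (e : 'I_N -> ('rV[R]_d -> R.-C)).
Hypotheses (N_gt0 : (0 < N)%N) (e_cont : forall i, C_on Om (e i)).
Hypothesis e_free : forall a : 'I_N -> R.-C,
  (forall x, Om x -> \sum_(i < N) a i * e i x = 0) -> forall i, a i = 0.

Definition basis_values (x : 'rV[R]_d) : 'rV[R[i]]_N := \row_i e i x.

Lemma pairing_basis a x : pairing a (basis_values x) = \sum_(i < N) a 0 i * e i x.
Proof. by apply: eq_bigr => i _; rewrite mxE. Qed.

Lemma C_on_pairing (a : 'rV[R[i]]_N) :
  C_on Om (fun x => pairing a (basis_values x) : R.-C).
Proof.
rewrite /C_on /=; under eq_fun do rewrite pairing_basis.
elim: (index_enum _) => [|i s IHs].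
  by under eq_fun do rewrite big_nil; move=> x; exact: cvg_cst.
under eq_fun do rewrite big_cons.
move=> x; apply: (@cvgD _ R.-C); last exact: IHs.
by apply: (@cvgM R[i]); [exact: cvg_cst|exact: e_cont].
Qed.

Let rho x := re_form (basis_values x).
Let sigma x := im_form (basis_values x).

Let rho_cont j : {within Om, continuous (fun x => rho x 0 j)}.
Proof.
case: (split_ordP j) => i ->; rewrite /rho /re_form.
  by under eq_fun do rewrite row_mxEl !mxE; exact: C_on_Re.
under eq_fun do rewrite row_mxEr !mxE.
by move=> x; apply: cvgN; exact: C_on_Im.
Qed.

Let sigma_cont j : {within Om, continuous (fun x => sigma x 0 j)}.
Proof.
case: (split_ordP j) => i ->; rewrite /sigma /im_form.
  by under eq_fun do rewrite row_mxEl !mxE; exact: C_on_Im.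
by under eq_fun do rewrite row_mxEr !mxE; exact: C_on_Re.
Qed.

Let Gr := gram_matrix Om mu rho sigma.

(** This is the trace formula for the rank-one form [v^T v]. *)
Lemma qf_gram_matrix a : qf Gr (real_coords a) (real_coords a) =
  \int[mu]_(x in Om) (Normc.normc (pairing a (basis_values x)) ^+ 2).
Proof.
rewrite qf_trace mxtrace_mulC (trace_gram_matrix Om_compact mu_Om) //.
apply: eq_Rintegral => x _; rewrite !qf_rank1 ![qf _ (real_coords a) _]qfC ?trmx1 //.
by rewrite re_formE im_formE sqr_normcE !expr2.
Qed.

(** The Gram matrix of the real and imaginary parts has the averaging property
    because mu is a probability measure on [Om]. *)
Theorem space_recovery :
  exists (k : nat) (x : 'I_k -> 'rV[R]_d) (L : 'rV[R[i]]_k -> 'rV[R[i]]_N),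
  [/\ [/\ (k <= 8 * N)%N, injective x & forall j, Om (x j)],
      forall (c : R[i]) v w, L (c *: v + w) = c *: L v + L w,
      forall a, L (\row_j pairing a (basis_values (x j))) = a,
      forall (v : 'rV[R[i]]_k) E, (forall j, Normc.normc (v 0 j) <= E) ->
        \int[mu]_(y in Om) (Normc.normc (pairing (L v) (basis_values y)) ^+ 2)
          <= 12 * E ^+ 2 &
      forall (v : 'rV[R[i]]_k) E y, (forall j, Normc.normc (v 0 j) <= E) -> Om y ->
        Normc.normc (pairing (L v) (basis_values y)) ^+ 2 <= 192 * N%:R * E ^+ 2].
Proof.
have mOm := compact_borel_measurable Om_compact.
have [b eb] : exists b, forall x i, Om x -> Normc.normc (basis_values x 0 i) <= b.
  have /choice[M hM] : forall i, exists M, 0 <= M /\ forall x, Om x -> Normc.normc (e i x) <= M.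
    by move=> i; have [M M0 hM] := C_on_bounded (@e_cont i); exists M.
  exists (\sum_i M i) => x i Ox; rewrite mxE (bigD1 i) //=.
  rewrite (le_trans ((hM i).2 x Ox)) // lerDl sumr_ge0 // => j _; exact: (hM j).1.
have ef a : (forall x, Om x -> pairing a (basis_values x) = 0) -> a = 0.
  move=> a0; apply/rowP => i; rewrite [RHS]mxE; apply: (e_free (a := fun i => a 0 i)) => x Ox.
  by rewrite -pairing_basis; exact: a0.
have avg (V : 'M[R]_(N + N)) c : (forall x, Om x -> qf V (rho x) (rho x) +
    qf V (sigma x) (sigma x) <= c) -> \tr (V *m Gr) <= c.
  move=> Vc; rewrite (trace_gram_matrix Om_compact mu_Om) //.
  have <- : \int[mu]_(x in Om) c = c.
    by rewrite Rintegral_cst // [X in fine X]mu_Om mulr1.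
  apply: le_Rintegral => //.
    by apply: (continuous_on_integrable Om_compact mu_Om); exact: qf_continuous.
  exact: finite_measure_integrable_cst.
have [k [x [L [H1 H2 H3 H4 H5]]]] :=
  stable_recovery N_gt0 eb ef (gram_matrix_sym Om mu rho sigma) avg.
exists k, x, L; split=> // v E vE.
by rewrite -qf_gram_matrix; exact: H4.
Qed.
End SpaceRecovery.

(** * Error in the Orlicz quasinorm *)

(** For nonnegative functions the integral is a supremum over simple functions
    below, and a supremum is monotone in the set; this is applied to Phi composed
    with the error. *)
Lemma le_integral_nonmeasurable d (T : measurableType d) (R : realType)
  (mu : {measure set T -> \bar R}) (D : set T) (f g : T -> \bar R) :
  (forall x, D x -> (0 <= f x)%E) -> (forall x, D x -> (f x <= g x)%E) ->
  (\int[mu]_(x in D) f x <= \int[mu]_(x in D) g x)%E.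
Proof.
move=> f0 fg; have g0 x : D x -> (0 <= g x)%E by move=> Dx; exact: le_trans (f0 x Dx) (fg x Dx).
rewrite !ge0_integralE //; apply: ereal_sup_le => _ [h hf <-].
exists h => // x; apply: le_trans (hf x) _.
by rewrite /patch; case: ifPn => // /set_mem /fg.
Qed.

Section ErrorBound.
Variables (R : realType) (d : nat) (Om : set 'rV[R]_d).
Variable mu : probability (borel 'rV[R]_d) R.
Hypotheses (Om_compact : compact Om) (mu_Om : mu Om = 1%E).
Variables (Phi : R -> R) (p a : R).
Hypotheses (p_ge2 : 2 <= p) (Phi_fun : Phi_function Phi).
Hypotheses (aPhi : aInc_with Phi p a) (Phi1_gt0 : 0 < Phi 1).

Lemma C_on_LPhi (f : 'rV[R]_d -> R.-C) : C_on Om f -> LPhi Om Phi mu f.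
Proof.
move=> cf; have mOm := compact_borel_measurable Om_compact; split.
  exact: within_measurable.
have [M M0 hM] := C_on_bounded Om_compact cf.
exists 1; split=> //; apply: (@le_lt_trans _ _ (Phi M)%:E); last by rewrite ltry.
rewrite /modular; apply: (@le_trans _ _ (\int[mu]_(x in Om) (Phi M)%:E)%E).
  apply: le_integral_nonmeasurable => x Ox; rewrite lee_fin divr1.
    by apply: (Phi_nonneg Phi_fun); exact: normc_ge0.
  by apply: (Phi_increasing Phi_fun); [exact: normc_ge0|exact: hM].
by rewrite integral_cst // [X in (_ * X)%E]mu_Om mule1.
Qed.

Variables (N : nat) (e : 'I_N -> ('rV[R]_d -> R.-C)).
Hypotheses (N_gt0 : (0 < N)%N) (e_cont : forall i, C_on Om (e i)).
Hypothesis e_free : forall a : 'I_N -> R.-C,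
  (forall x, Om x -> \sum_(i < N) a i * e i x = 0) -> forall i, a i = 0.

Let NR : 0 < N%:R :> R. Proof. by rewrite ltr0n. Qed.

(** A function bounded by 20 E in L^2(mu) and by 20 sqrt N E uniformly has
    modular at most 1 at the level 20 M E.  The continuous majorant [q] of |h|^2
    carries both bounds. *)
Lemma LPhi_norm_le (h : 'rV[R]_d -> R.-C) (q : 'rV[R]_d -> R) E : 0 < E ->
  {within Om, continuous q} -> \int[mu]_(x in Om) q x <= (20 * E) ^+ 2 ->
  (forall x, Om x -> Normc.normc (h x) ^+ 2 <= q x) ->
  (forall x, Om x -> q x <= N%:R * (20 * E) ^+ 2) ->
  (LPhi_norm Om Phi mu h <= (20 * growth_factor Phi p a N * E)%:E)%E.
Proof.
move=> E0 cq intq hq qN; have mOm := compact_borel_measurable Om_compact.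
have M1 := growth_factor_ge1 p_ge2 Phi_fun aPhi Phi1_gt0 N_gt0.
set M := growth_factor _ _ _ _ in M1 *.
have M0 : 0 < M by apply: lt_le_trans M1.
have E20 : 0 < 20 * E by rewrite mulr_gt0.
apply: ereal_inf_lbound; exists (20 * M * E) => //=; split.
  by rewrite !mulr_gt0.
have cq' : {within Om, continuous (fun x => ((20 * E) ^+ 2)^-1 * q x)}.
  by move=> x; apply: cvgM; [exact: cvg_cst|exact: cq].
apply: (@le_trans _ _ (\int[mu]_(x in Om) (((20 * E) ^+ 2)^-1 * q x)%:E)%E).
  apply: le_integral_nonmeasurable => x Ox; rewrite lee_fin.
    by apply: (Phi_nonneg Phi_fun); rewrite divr_ge0 ?normc_ge0 // !mulr_ge0 ?ltW.
  set z := Normc.normc (h x).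
  have -> : z / (20 * M * E) = z / (20 * E) / M.
    by rewrite mulrAC invfM mulrA.
  have zq : (z / (20 * E)) ^+ 2 <= ((20 * E) ^+ 2)^-1 * q x.
    by rewrite expr_div_n mulrC ler_pM2l ?invr_gt0 ?exprn_gt0 //; exact: hq.
  apply: le_trans zq; apply: (Phi_le_sqr p_ge2 Phi_fun aPhi Phi1_gt0 N_gt0).
    by rewrite divr_ge0 ?normc_ge0 ?ltW.
  rewrite -[leLHS]ger0_norm ?divr_ge0 ?normc_ge0 ?(ltW E20) // -sqrtr_sqr ler_wsqrtr //.
  rewrite expr_div_n ler_pdivrMr ?exprn_gt0 //; apply: le_trans (qN x Ox); exact: hq.
have iq := continuous_on_integrable Om_compact mu_Om cq'.
have -> : (\int[mu]_(x in Om) (((20 * E) ^+ 2)^-1 * q x)%:E =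
           (\int[mu]_(x in Om) (((20 * E) ^+ 2)^-1 * q x))%:E)%E.
  by rewrite /Rintegral fineK //; exact: integrable_fin_num.
rewrite lee_fin RintegralZl //; last exact: continuous_on_integrable.
by rewrite ler_pdivrMl ?exprn_gt0 // mulr1.
Qed.

(** Since T reproduces the space, f - T f = (f - u) - T (f - u), and
    |f - T f|^2 <= 2 E^2 + 2 |T (f - u)|^2. *)
Theorem projection_error :
  exists (k : nat) (x : 'I_k -> 'rV[R]_d) (T : 'rV[R.-C]_k -> 'rV[R]_d -> R.-C),
  [/\ (k <= 8 * N)%N, injective x, forall j, Om (x j), LPhi_linear Om Phi mu T &
    forall (f : 'rV[R]_d -> R.-C) (c : 'I_N -> R.-C) E, 0 < E ->
      (forall y, Om y -> Normc.normc (f y - \sum_(i < N) c i * e i y) <= E) ->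
      (LPhi_norm Om Phi mu (fun y => (f y - T (\row_j f (x j)) y)%R) <=
       (20 * growth_factor Phi p a N * E)%:E)%E].
Proof.
have [k [x [L [[kN xinj xOm] Llin Lproj Lint Lsup]]]] :=
  space_recovery Om_compact mu_Om N_gt0 e_cont e_free.
have mOm := compact_borel_measurable Om_compact.
pose T (v : 'rV[R.-C]_k) : 'rV[R]_d -> R.-C := fun y => pairing (L v) (basis_values e y).
exists k, x, T; split=> //.
  split=> [v|c v w]; first by apply: C_on_LPhi; exact: C_on_pairing.
  apply: aeW => y _; rewrite /T (Llin c v w) /pairing mulr_sumr -big_split /=.
  by apply: eq_bigr => i _; rewrite !mxE mulrDl mulrA.
move=> f c E E0 fc.
pose u y : R[i] := \sum_(i < N) c i * e i y.
pose ca : 'rV[R[i]]_N := \row_i c i.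
have uE y : u y = pairing ca (basis_values e y).
  by rewrite pairing_basis; apply: eq_bigr => i _; rewrite mxE.
pose v : 'rV[R[i]]_k := \row_j (f (x j) - u (x j)).
have vE j : Normc.normc (v 0 j) <= E by rewrite mxE; exact: fc.
have Lf : L (\row_j f (x j)) = L v + ca.
  rewrite -[ca in RHS]Lproj -[L v]scale1r -Llin scale1r; congr L.
  by apply/rowP => j; rewrite !mxE -uE subrK.
pose w y := Normc.normc (pairing (L v) (basis_values e y)) ^+ 2.
have cw : {within Om, continuous w}.
  by apply: C_on_sqr_normc; exact: C_on_pairing.
have cw2 : {within Om, continuous (fun y => 2 * w y)}.
  by move=> y; apply: cvgM; [exact: cvg_cst|exact: cw].
apply: (@LPhi_norm_le _ (fun y => 2 * E ^+ 2 + 2 * w y)) => //.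
- by move=> y; apply: cvgD; [exact: cvg_cst|exact: cw2].
- rewrite RintegralD //; first last.
  + exact: continuous_on_integrable.
  + exact: finite_measure_integrable_cst.
  rewrite Rintegral_cst // [X in fine X]mu_Om mulr1.
  rewrite RintegralZl //; last exact: continuous_on_integrable.
  by have := Lint v E vE; rewrite -/(w _); have := sqr_ge0 E; lra.
- move=> y Oy.
  have -> : f y - T (\row_j f (x j)) y = (f y - u y) + - pairing (L v) (basis_values e y).
    rewrite /T Lf /pairing uE /pairing -addrA -opprD; congr (_ - _).
    by rewrite -big_split /=; apply: eq_bigr => i _; rewrite mxE mulrDl addrC.
  apply: le_trans (sqr_normcD _ _) _; rewrite normc_opp lerD2r ler_wpM2l //.
  by rewrite lerXn2r ?nnegrE ?normc_ge0 ?(ltW E0) //; exact: fc.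
- move=> y Oy; have := Lsup v E y vE Oy; rewrite -/(w y).
  have : E ^+ 2 <= N%:R * E ^+ 2 by rewrite ler_peMl ?sqr_ge0 // ler1n.
  have -> : N%:R * (20 * E) ^+ 2 = 400 * (N%:R * E ^+ 2) by ring.
  by have := sqr_ge0 E; lra.
Qed.
End ErrorBound.

(** * Sampling numbers and widths *)

Section SamplingBound.
Variables (R : realType) (d : nat) (Om : set 'rV[R]_d).
Variable mu : probability (borel 'rV[R]_d) R.
Hypotheses (Om_compact : compact Om) (mu_Om : mu Om = 1%E).
Variables (Phi : R -> R) (p a : R).
Hypotheses (p_ge2 : 2 <= p) (Phi_fun : Phi_function Phi).
Hypotheses (aPhi : aInc_with Phi p a) (Phi1_gt0 : 0 < Phi 1).

Lemma sampling_number_le (N : nat) (F : set ('rV[R]_d -> R.-C)) (kappa : R) :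
  (0 < N)%N -> 20 * growth_factor Phi p a N <= kappa ->
  (sampling_number Om Phi mu (8 * N%:R)%R F <=
   kappa%:E * kolmogorov_width Om N F)%E.
Proof.
move=> N0 hk; have M1 := growth_factor_ge1 p_ge2 Phi_fun aPhi Phi1_gt0 N0.
have k0 : 0 < kappa by lra.
have [x0 Ox0] : Om !=set0.
  apply/set0P/negP => /eqP Om0; move: mu_Om; rewrite Om0 measure0 => /eqP.
  by rewrite eqe eq_sym oner_eq0.
rewrite -lee_pdivrMl //; apply: le_ereal_inf_tmp => _ [X [e [eC eF ->]] <-].
rewrite lee_pdivrMl //.
have [k [x [T [kN xinj xOm TL Terr]]]] :=
  projection_error Om_compact mu_Om p_ge2 Phi_fun aPhi Phi1_gt0 N0 eC eF.
apply: (@le_trans _ _ (sampling_error Om Phi mu x T F)).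
  apply: (@le_trans _ _ (ereal_inf
    [set sampling_error Om Phi mu x T F | T in LPhi_linear Om Phi mu (k := k)])).
    apply: ereal_inf_lbound; exists k, x; split=> //.
    by rewrite -natrM ler_nat.
  by apply: ereal_inf_lbound; exists T.
apply: ge_ereal_sup => _ [f Ff <-]; rewrite -lee_pdivrMl //.
apply: le_trans (ereal_sup_ubound _); last by exists f.
apply: le_ereal_inf_tmp => _ [_ [c ->] <-]; rewrite lee_pdivrMl //.
set S := sup_norm _ _.
have S_ub y : Om y -> ((Normc.normc (f y - \sum_(i < N) c i * e i y))%:E <= S)%E.
  by move=> Oy; apply: ereal_sup_ubound; exists y.
case: S S_ub => [r||] S_ub; last 2 first.
- by rewrite gt0_muley ?lte_fin // leey.
- by have := S_ub x0 Ox0; rewrite leNgt ltNyr.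
have r0 : 0 <= r.
  by have := S_ub x0 Ox0; rewrite lee_fin; apply: le_trans; exact: normc_ge0.
(* A positive bound is needed to scale by, and f may lie in the space: hence the
   slack eps / kappa. *)
apply/lee_addgt0Pr => eps eps0.
have E0 : 0 < r + eps / kappa by rewrite ltr_wpDl // divr_gt0.
apply: le_trans (Terr f c _ E0 _) _.
  move=> y Oy; have := S_ub y Oy; rewrite lee_fin => /le_trans; apply.
  by rewrite lerDl ltW // divr_gt0.
rewrite -EFinM -EFinD lee_fin.
apply: (@le_trans _ _ (kappa * (r + eps / kappa))); first by rewrite ler_wpM2r // ltW.
by rewrite mulrDr mulrCA mulfV ?mulr1 // gt_eqF.
Qed.
End SamplingBound.

Section QuasiTriangle.
Variables (R : realType) (Phi : R -> R).
Hypothesis Phi_fun : Phi_function Phi.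

Lemma LPhi_norm_cst d (Om : set 'rV[R]_d) (mu : probability (borel 'rV[R]_d) R) c :
  compact Om -> mu Om = 1%E ->
  LPhi_norm Om Phi mu (fun=> c) =
  ereal_inf [set l%:E | l in [set l : R | 0 < l /\ Phi (Normc.normc c / l) <= 1]].
Proof.
move=> cOm mu1; have mOm := compact_borel_measurable cOm.
have mE l : modular Om Phi mu (fun=> c) l = (Phi (Normc.normc c / l))%:E.
  by rewrite /modular integral_cst // [X in (_ * X)%E]mu1 mule1.
congr (ereal_inf (image _ _)); apply/seteqP; split=> l /= [l0];
  by rewrite mE lee_fin.
Qed.

(** Test the inequality on 1 + 0 over a one-point space: the quasinorm of the
    constant 1 is positive because Phi tends to infinity, and finite because Phi
    tends to 0 at 0. *)
Lemma quasi_triangle_constant_ge1 K : quasi_triangle_constant Phi K -> 1 <= K.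
Proof.
move=> [K0 HK].
pose Om : set 'rV[R]_1 := [set 0].
pose mu : probability (borel 'rV[R]_1) R := \d_(0 : borel 'rV[R]_1).
have cOm : compact Om by exact: compact_set1.
have mu1 : mu Om = 1%E by rewrite /mu /= diracE mem_set.
pose one : R.-C := (1 : R[i]).
have Lc (c : R.-C) : LPhi Om Phi mu (fun=> c).
  by apply: C_on_LPhi => //; move=> x; exact: cvg_cst.
have := HK _ _ _ cOm mu1 _ _ (Lc one) (Lc 0).
have -> : (fun x : 'rV[R]_1 => one + 0) = (fun=> one) by apply/funext => x; rewrite addr0.
have -> : LPhi_norm Om Phi mu (fun=> (0 : R.-C)) = 0%E.
  rewrite LPhi_norm_cst //; apply/eqP; rewrite eq_le; apply/andP; split; last first.
    by apply: le_ereal_inf_tmp => _ [l [l0 _] <-]; rewrite lee_fin ltW.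
  apply/lee_addgt0Pr => eps eps0; rewrite add0e; apply: ereal_inf_lbound.
  by exists eps => //; split=> //; rewrite Normc.normc0 mul0r (Phi_zero Phi_fun).
rewrite adde0 LPhi_norm_cst // Normc.normc1.
set S := ereal_inf _.
have S0 : (0 < S)%E.
  have /cvgryPgt/(_ 1) [t0 [_ ht0]] := Phi_cvgy Phi_fun.
  apply: (@lt_le_trans _ _ (`|t0| + 1)^-1%:E).
    by rewrite lte_fin invr_gt0 ltr_wpDl.
  apply: le_ereal_inf_tmp => _ [l [l0 hl] <-]; rewrite lee_fin leNgt.
  apply/negP => lt; move: hl; apply/negP; rewrite -ltNge; apply: ht0.
  rewrite div1r; apply: (@lt_trans _ _ (`|t0| + 1)).
    by apply: le_lt_trans (ler_norm _) _; rewrite ltrDl.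
  by rewrite -[ltLHS]invrK ltf_pV2 // posrE invr_gt0 ltr_wpDl.
have Sy : (S < +oo)%E.
  have [t t0 ht] : exists2 t, 0 < t & Phi t <= 1.
    have /cvgrPdist_le/(_ 1 ltr01) h := Phi_cvg0 Phi_fun.
    near (0 : R)^'+ => t; exists t => //.
    apply: le_trans (ler_norm _) _; rewrite -normrN -[- _]add0r; near: t; exact: h.
  apply: le_lt_trans (ltry t^-1); apply: ereal_inf_lbound; exists t^-1 => //.
  by split; [rewrite invr_gt0|rewrite div1r invrK].
case: S S0 Sy => [s||] //; rewrite lte_fin => s0 _; rewrite -EFinM lee_fin.
by rewrite ler_pMl.
Unshelve. all: by end_near. Qed.
End QuasiTriangle.

Theorem theorem6p4 (R : realType) :
  exists c C : R, 1 <= c /\ 1 <= C /\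
  forall (p : R) (Phi : R -> R),
    2 <= p -> Phi_function Phi -> aInc Phi p -> 0 < Phi 1 ->
    let bound (K : R) :=
      forall (N : nat) (d : nat) (Omega : set 'rV[R]_d)
        (mu : probability (borel 'rV[R]_d) R)
        (F : set ('rV[R]_d -> R.-C)),
        (1 <= N)%N -> compact Omega -> mu Omega = 1%E -> F `<=` C_on Omega ->
        (sampling_number Omega Phi mu (c * N%:R)%R F <=
         (K * (Phi (Num.sqrt N%:R) / N%:R) `^ p^-1)%R%:E *
           kolmogorov_width Omega N F)%E in
    (exists K : R, 1 <= K /\ bound K) /\
    (forall a_Phi C_Phi : R,
       aInc_with Phi p a_Phi -> quasi_triangle_constant Phi C_Phi ->
       let K := C * C_Phi * a_Phi `^ (2 / p) *
                (1 + (Phi 1)^-1) `^ p^-1 in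
       1 <= K /\ bound K).
Proof.
exists 8, 20; split; first by rewrite ler1n.
split; first by rewrite ler1n.
move=> p Phi p2 PhiF [a0 aPhi0] Phi1 bound.
have main a Q : aInc_with Phi p a -> 1 <= Q ->
    let K := 20 * Q * a `^ (2 / p) * (1 + (Phi 1)^-1) `^ p^-1 in 1 <= K /\ bound K.
  move=> aPhi Q1 K; have a1 : 1 <= a by case: aPhi.
  have p0 : 0 <= p^-1 by rewrite invr_ge0 (le_trans _ p2).
  have b1 : 1 <= a `^ (2 / p).
    by rewrite -[leLHS](powRr0 a) ler_powR // mulr_ge0.
  have q1 : 1 <= (1 + (Phi 1)^-1) `^ p^-1.
    by rewrite -[leLHS](powRr0 (1 + (Phi 1)^-1)) ler_powR // lerDl invr_ge0 ltW.
  have K20 : 20 * (a `^ (2 / p) * (1 + (Phi 1)^-1) `^ p^-1) <= K.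
    rewrite /K -!mulrA ler_wpM2l // ler_peMl // mulr_ge0 //; exact: le_trans ler01 _.
  split.
    apply: le_trans K20; have : 1 <= a `^ (2 / p) * (1 + (Phi 1)^-1) `^ p^-1.
      by rewrite mulr_ege1.
    by lra.
  move=> N d Om mu F N1 cOm mu1 _.
  apply: (sampling_number_le cOm mu1 p2 PhiF aPhi Phi1) => //.
  have y0 : 0 <= Phi (Num.sqrt N%:R) / N%:R.
    by rewrite divr_ge0 //; apply: (Phi_nonneg PhiF); exact: sqrtr_ge0.
  have z0 : 0 <= 1 + (Phi 1)^-1 by rewrite addr_ge0 // invr_ge0 ltW.
  have a20 : 0 <= a ^+ 2 by exact: sqr_ge0.
  rewrite /growth_factor (powRM _ (mulr_ge0 a20 z0) y0) (powRM _ a20 z0).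
  rewrite -powR_mulrn ?(le_trans ler01 a1) // -powRrM mulrA.
  by rewrite ler_wpM2r ?powR_ge0.
split.
  have [K1 Kb] := main a0 1 aPhi0 (lexx 1).
  by exists (20 * 1 * a0 `^ (2 / p) * (1 + (Phi 1)^-1) `^ p^-1).
move=> a Q aPhi HQ; apply: main => //; exact: quasi_triangle_constant_ge1 HQ.
Qed.
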